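(* Let $\mathcal{J}_1,\mathcal{J}_2$ be Euclidean Jordan algebras with ranks $r_1,r_2$ and cones of squares $\mathcal{K}_1,\mathcal{K}_2$. Let $f:\mathcal{J}_1\times\mathcal{J}_2\to\mathbb{R}$ be differentiable, convex in its first argument and concave in its second argument, and consider the two-player zero-sum game on $\Delta_{\mathcal{K}_1}\times\Delta_{\mathcal{K}_2}$ with utilities $u_2=-u_1=f$ and payoff vectors $m_1(x,y)=-\nabla_x f(x,y)$, $m_2(x,y)=\nabla_y f(x,y)$. Assume there are constants $L_1,L_2\ge0$, not both zero, such that for $i=1,2$ and all $z,z'\in\Delta_{\mathcal{K}_1}\times\Delta_{\mathcal{K}_2}$, $$\|m_i(z)-m_i(z')\|_{\operatorname{tr},\infty}\le L_i\|z-z'\|_{\operatorname{tr},1}.$$ Let $\varepsilon>0$ and suppose both players run OSCMWU (defined in the context) with stepsize $\eta=\dfrac{1}{2\sqrt{2(L_1^2+L_2^2)}}$ for $T$ rounds, where $T\ge1$ and $$T\ge\frac{2(\ln r_1+\ln r_2)\sqrt{2(L_1^2+L_2^2)}}{\varepsilon},$$ producing iterates $(x^t,y^t)$. Let $\bar x_T=\frac1T\sum_{t=1}^Tx^t$ and $\bar y_T=\frac1T\sum_{t=1}^Ty^t$. Then $$0\le d(\bar x_T,\bar y_T)\le\varepsilon,\qquad 0\le d_1(\bar x_T)\le\varepsilon,\qquad 0\le d_2(\bar y_T)\le\varepsilon,$$ where, with $v^*=\min_{x\in\Delta_{\mathcal{K}_1}}\max_{y\in\Delta_{\mathcal{K}_2}}f(x,y)=\max_{y\in\Delta_{\mathcal{K}_2}}\min_{x\in\Delta_{\mathcal{K}_1}}f(x,y)$,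 $$d(\bar x,\bar y)=\max_{y\in\Delta_{\mathcal{K}_2}}f(\bar x,y)-\min_{x\in\Delta_{\mathcal{K}_1}}f(x,\bar y),\quad d_1(\bar x)=\max_{y\in\Delta_{\mathcal{K}_2}}f(\bar x,y)-v^*,\quad d_2(\bar y)=v^*-\min_{x\in\Delta_{\mathcal{K}_1}}f(x,\bar y).$$ Moreover $(\bar x_T,\bar y_T)$ is an $\varepsilon$-saddle point: for all $(x,y)\in\Delta_{\mathcal{K}_1}\times\Delta_{\mathcal{K}_2}$, $$f(\bar x_T,y)-\varepsilon\le f(\bar x_T,\bar y_T)\le f(x,\bar y_T)+\varepsilon .$$
   Context: A Euclidean Jordan algebra (EJA) is a finite-dimensional real vector space $\mathcal{J}$ with a bilinear product $\circ$ satisfying $x\circ y=y\circ x$ and $x^2\circ(x\circ y)=x\circ(x^2\circ y)$, with an identity element $e$ and an associative inner product ($(x\circ y,z)=(y,x\circ z)$). Its cone of squares is $\mathcal{K}=\{x\circ x:x\in\mathcal{J}\}$. A Jordan frame is a set $\{q_1,\dots,q_r\}$ of primitive idempotents (nonzero idempotents that are not sums of two nonzero idempotents) with $q_i\circ q_j=0$ for $i\neq j$ and $\sum_iq_i=e$; $r$ is the rank of $\mathcal{J}$ (the maximum over elements of the degree of the minimal polynomial). Every $x\in\mathcal{J}$ has a spectral decomposition $x=\sum_{i=1}^r\lambda_iq_i$ with a Jordan frame $\{q_i\}$ and eigenvalues $\lambda_i\in\mathbb{R}$, unique up to order with multiplicities. Set $\operatorname{tr}(x)=\sum_i\lambda_i$,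 $\exp(x)=\sum_ie^{\lambda_i}q_i$, $\|x\|_{\operatorname{tr},1}=\sum_i|\lambda_i|$, $\|x\|_{\operatorname{tr},\infty}=\max_i|\lambda_i|$. The inner product used on $\mathcal{J}$ (and for gradients) is $\langle x,y\rangle=\operatorname{tr}(x\circ y)$. The generalized simplex is $\Delta_{\mathcal{K}}=\{x\in\mathcal{K}:\operatorname{tr}(x)=1\}$. On the product EJA $\mathcal{J}_1\times\mathcal{J}_2$ (componentwise product), the eigenvalues of $(x,y)$ are those of $x$ together with those of $y$, so $\|(x,y)\|_{\operatorname{tr},1}=\|x\|_{\operatorname{tr},1}+\|y\|_{\operatorname{tr},1}$. OSCMWU: write $z_1^t=x^t$, $z_2^t=y^t$ and $m_i^t=m_i(x^t,y^t)$. Each player $i\in\{1,2\}$ starts at $z_i^0=e_i/r_i$ ($e_i$ the identity of $\mathcal{J}_i$; this is the minimizer over $\Delta_{\mathcal{K}_i}$ of the negative entropy $\operatorname{tr}(z\circ\ln z)$), and for all $t\ge0$ $$w_i^{t+1}=\eta\Big(\sum_{k=1}^tm_i^k+m_i^t\Big),\qquad z_i^{t+1}=\frac{\exp(w_i^{t+1})}{\operatorname{tr}(\exp(w_i^{t+1}))}.$$ *)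

(* Defs.v *)
From HB Require Import structures.
From mathcomp Require Import all_boot all_order all_algebra.
From mathcomp Require Import all_classical all_reals all_analysis.
From mathcomp Require Import ring lra.

Set Implicit Arguments.
Unset Strict Implicit.
Unset Printing Implicit Defensive.

Import Order.TTheory GRing.Theory Num.Theory.
Import numFieldNormedType.Exports.

Local Open Scope classical_set_scope.
Local Open Scope ring_scope.

(** * Euclidean Jordan algebras *)

(* The zero algebra is excluded by [jone_neq0]: it has rank 0, no element of
   trace 1, and hence an empty generalized simplex. *)
HB.mixin Record Vector_isEJA (R : realType) J & Vector R J := {
  jmul : J -> J -> J ;
  jone : J ;
  jform : J -> J -> R ;
  jmulC : commutative jmul ;
  jmul_linearl : forall z, linear (jmul ^~ z) ;
  jordan_identity : forall x y,
    jmul (jmul x x) (jmul x y) = jmul x (jmul (jmul x x) y) ;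
  jmul1x : left_id jone jmul ;
  jone_neq0 : jone <> 0 ;
  jformC : forall x y, jform x y = jform y x ;
  jform_linearl : forall (a : R) (x y z : J),
    jform (a *: x + y) z = a * jform x z + jform y z ;
  jform_gt0 : forall x, x != 0 -> 0 < jform x x ;
  jformA : forall x y z, jform (jmul x y) z = jform y (jmul x z)
}.

#[short(type="ejaType")]
HB.structure Definition EJA (R : realType) :=
  {J of Vector R J & Vector_isEJA R J}.

Arguments jone {R J} : rename.

Section form_norm.
Context {R : realType} (J : ejaType R).
Implicit Types (x y z : J) (a : R).

Definition jnorm x : R := Num.sqrt (jform x x).

Lemma jform_linearr a x y z : jform z (a *: x + y) = a * jform z x + jform z y.
Proof. by rewrite jformC jform_linearl ![jform _ z]jformC. Qed.

Lemma jform0l z : jform 0 z = 0.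
Proof.
by have := jform_linearl (-1) (0 : J) 0 z; rewrite scaler0 addr0 mulN1r addNr.
Qed.

Lemma jform_ge0 x : 0 <= jform x x.
Proof. by have [->|/jform_gt0/ltW//] := eqVneq x 0; rewrite jform0l. Qed.

Lemma jformZ a x : jform (a *: x) (a *: x) = a ^+ 2 * jform x x.
Proof.
rewrite -[a *: x]addr0 jform_linearl jform_linearr.
by rewrite jform0l [jform x 0]jformC jform0l; ring.
Qed.

Lemma jform_sqrD a x y : jform (a *: x + y) (a *: x + y) =
  a ^+ 2 * jform x x + 2 * a * jform x y + jform y y.
Proof. by rewrite jform_linearl !jform_linearr [jform y x]jformC; ring. Qed.

Lemma jform_cauchy_schwarz x y : jform x y ^+ 2 <= jform x x * jform y y.
Proof.
have [->|/jform_gt0 x0] := eqVneq x 0; first by rewrite !jform0l expr0n mul0r.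
have := jform_ge0 (- (jform x y / jform x x) *: x + y).
rewrite jform_sqrD -(pmulr_rge0 _ x0).
have -> : jform x x * ((- (jform x y / jform x x)) ^+ 2 * jform x x +
    2 * - (jform x y / jform x x) * jform x y + jform y y) =
  jform x x * jform y y - jform x y ^+ 2 by field; rewrite gt_eqF.
by rewrite subr_ge0.
Qed.

Lemma ler_jnormD x y : jnorm (x + y) <= jnorm x + jnorm y.
Proof.
rewrite -[leRHS]ger0_norm ?addr_ge0 ?sqrtr_ge0// -sqrtr_sqr ler_wsqrtr//.
rewrite -{1 2}[x]scale1r jform_sqrD sqrrD !sqr_sqrtr ?jform_ge0//.
rewrite expr1n !mul1r mulr1 lerD2r lerD2l mulr_natl ler_wMn2r//.
rewrite (le_trans (ler_norm _))// -sqrtr_sqr -sqrtrM ?jform_ge0//.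
by rewrite ler_wsqrtr// jform_cauchy_schwarz.
Qed.

Lemma jnormZ a x : jnorm (a *: x) = `|a| * jnorm x.
Proof. by rewrite /jnorm jformZ sqrtrM ?sqr_ge0// sqrtr_sqr. Qed.

Lemma jnorm0_eq0 x : jnorm x = 0 -> x = 0.
Proof.
have [//|/jform_gt0 x0] := eqVneq x 0.
by move=> /eqP; rewrite gt_eqF// sqrtr_gt0.
Qed.

End form_norm.

(* The topology of an EJA, needed to speak of differentiability, is that of the
   norm of its associative inner product (all norms on a finite-dimensional
   space being equivalent). *)
#[non_forgetful_inheritance]
HB.instance Definition _ (R : realType) (J : ejaType R) :=
  Lmodule_isNormed.Build R (EJA.sort J) (@ler_jnormD R J) (@jnormZ R J)
    (@jnorm0_eq0 R J).

Section product_eja.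
Context {R : realType} (J1 J2 : ejaType R).
Implicit Types x y z : (J1 * J2)%type.

Definition pair_jmul x y : (J1 * J2)%type := (jmul x.1 y.1, jmul x.2 y.2).
Definition pair_jone : (J1 * J2)%type := (jone, jone).
Definition pair_jform x y : R := jform x.1 y.1 + jform x.2 y.2.

Fact pair_jmulC : commutative pair_jmul.
Proof. by move=> x y; rewrite /pair_jmul jmulC [jmul x.2 _]jmulC. Qed.

Fact pair_jmul_linearl z : linear (pair_jmul ^~ z).
Proof. by move=> a x y; congr pair; rewrite /= jmul_linearl. Qed.

Fact pair_jordan_identity x y : pair_jmul (pair_jmul x x) (pair_jmul x y) =
  pair_jmul x (pair_jmul (pair_jmul x x) y).
Proof. by rewrite /pair_jmul /= !jordan_identity. Qed.

Fact pair_jmul1x : left_id pair_jone pair_jmul.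
Proof. by case=> x y; rewrite /pair_jmul /= !jmul1x. Qed.

Fact pair_jone_neq0 : pair_jone <> 0.
Proof. by case=> /jone_neq0. Qed.

Fact pair_jformC x y : pair_jform x y = pair_jform y x.
Proof. by rewrite /pair_jform jformC [jform x.2 _]jformC. Qed.

Fact pair_jform_linearl (a : R) x y z :
  pair_jform (a *: x + y) z = a * pair_jform x z + pair_jform y z.
Proof. by rewrite /pair_jform /= !jform_linearl; ring. Qed.

Fact pair_jform_gt0 x : x != 0 -> 0 < pair_jform x x.
Proof.
case: x => x y; rewrite /pair_jform /= => xy0.
have [x0|/jform_gt0 x0] := eqVneq x 0; last by rewrite ltr_wpDr ?jform_ge0.
rewrite ltr_wpDl ?jform_ge0// jform_gt0//.
by apply: contra_neq xy0 => ->; rewrite x0.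
Qed.

Fact pair_jformA x y z :
  pair_jform (pair_jmul x y) z = pair_jform y (pair_jmul x z).
Proof. by rewrite /pair_jform /= !jformA. Qed.

HB.instance Definition _ := Vector_isEJA.Build R (J1 * J2)%type
  pair_jmulC pair_jmul_linearl pair_jordan_identity pair_jmul1x pair_jone_neq0
  pair_jformC pair_jform_linearl pair_jform_gt0 pair_jformA.

End product_eja.

(** * Rank and spectral decomposition *)

Definition is_max d (T : porderType d) (A : set T) (m : T) :=
  A m /\ ubound A m.
Definition is_min d (T : porderType d) (A : set T) (m : T) :=
  A m /\ lbound A m.

Section spectral.
Context {R : realType} (J : ejaType R).
Implicit Types (x y z c : J) (p : {poly R}).

Definition jpow x (n : nat) : J := iter n (jmul x) jone.

Definition jhorner p x : J := \sum_(i < size p) p`_i *: jpow x i.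

Definition is_minpoly x p := [/\ p \is monic, jhorner p x = 0 &
  forall q : {poly R}, q != 0 -> jhorner q x = 0 -> (size p <= size q)%N].

Definition rank : nat := xget 0%N [set r | is_max
  [set k : nat | exists x p, is_minpoly x p /\ k = (size p).-1] r].

Definition idempotent_elt c := jmul c c = c.

Definition primitive_idempotent c :=
  [/\ c <> 0, idempotent_elt c & ~ (exists a b, [/\ a <> 0, b <> 0,
    idempotent_elt a, idempotent_elt b & c = a + b])].

Definition jordan_frame (q : {ffun 'I_rank -> J}) :=
  [/\ forall i, primitive_idempotent (q i),
      forall i j, i != j -> jmul (q i) (q j) = 0 &
      \sum_i q i = jone].

Definition spectral_decomposition x
    (lq : {ffun 'I_rank -> R} * {ffun 'I_rank -> J}) :=
  jordan_frame lq.2 /\ x = \sum_i lq.1 i *: lq.2 i.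

(* A spectral decomposition picked by choice; the functions of the eigenvalues
   below do not depend on which one, by the spectral theorem. *)
Definition spectral x : {ffun 'I_rank -> R} * {ffun 'I_rank -> J} :=
  xget ([ffun=> 0], [ffun=> 0]) [set lq | spectral_decomposition x lq].

Definition eigval x (i : 'I_rank) : R := (spectral x).1 i.
Definition eigproj x (i : 'I_rank) : J := (spectral x).2 i.

Definition jtr x : R := \sum_i eigval x i.

Definition jexp x : J := \sum_i expR (eigval x i) *: eigproj x i.

Definition norm_tr1 x : R := \sum_i `|eigval x i|.

Definition norm_troo x : R := \big[Num.max/0]_i `|eigval x i|.

Definition tr_inner x y : R := jtr (jmul x y).

Definition cone_of_squares : set J := [set jmul x x | x in setT].

Definition simplex : set J := [set x | cone_of_squares x /\ jtr x = 1].

(* Gradient of [g] at [x] with respect to the trace inner product; meaningful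
   when [g] is differentiable at [x]. *)
Definition grad (g : J -> R) x : J :=
  xget 0 [set v | forall h, 'd g x h = tr_inner v h].

(* Iterates of a player with stepsize [eta] who receives the payoff vector
   [m t] at round [t]. *)
Definition oscmwu (eta : R) (m z : nat -> J) :=
  z 0%N = (rank%:R)^-1 *: jone /\
  forall t, let w := eta *: (\sum_(1 <= k < t.+1) m k + m t) in
    z t.+1 = (jtr (jexp w))^-1 *: jexp w.

End spectral.

Arguments simplex {R} J.
Arguments rank {R} J.

(** * Two-player zero-sum games *)

Section game.
Context {R : realType} {J1 J2 : ejaType R}.
Variable f : J1 * J2 -> R.
Implicit Types (x : J1) (y : J2).

Definition payoff1 (z : J1 * J2) : J1 := - grad (fun x => f (x, z.2)) z.1.
Definition payoff2 (z : J1 * J2) : J2 := grad (fun y => f (z.1, y)) z.2.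

Definition values_y x : set R := [set f (x, y) | y in simplex J2].
Definition values_x y : set R := [set f (x, y) | x in simplex J1].

Definition max_y x : R := sup (values_y x).
Definition min_x y : R := inf (values_x y).

Definition minmax : R := inf [set max_y x | x in simplex J1].
Definition maxmin : R := sup [set min_x y | y in simplex J2].

(* The suprema and infima above are maxima and minima, and the game has a
   value. *)
Definition has_value :=
  [/\ forall x, simplex J1 x -> is_max (values_y x) (max_y x),
      forall y, simplex J2 y -> is_min (values_x y) (min_x y),
      is_min [set max_y x | x in simplex J1] minmax,
      is_max [set min_x y | y in simplex J2] maxmin &
      minmax = maxmin].

Definition gap x y : R := max_y x - min_x y.
Definition gap1 x : R := max_y x - minmax.
Definition gap2 y : R := minmax - min_x y.

Definition saddle_point (eps : R) x y :=
  forall x' y', simplex J1 x' -> simplex J2 y' ->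
    f (x, y') - eps <= f (x, y) <= f (x', y) + eps.

End game.

(* Main.v *)
(* The norms, the trace and the step of OSCMWU are all spectral, so the Jordan
   algebra enters through three facts: the spectral theorem, the linearity and
   associativity of the trace, and Pinsker's inequality for the Bregman
   divergence of ln tr exp.

   Linearity of the trace: for a primitive idempotent c the operator
   P(c) = 2 L_c^2 - L_c has image R c.  Self-adjointness of P(c) and P(d) gives
   jform c c = jform d d as soon as jform c d <> 0, and therefore, for one fixed
   Jordan frame q, the functional x |-> sum_i jform x (q i) / jform (q i) (q i)
   equals 1 on every primitive idempotent.

   Pinsker's inequality: with z = sum_i z_i q_i, u = sum_j u_j p_j of trace 1
   and s the sign of z - u, one has
     |z - u|_1 = sum_(i,j) (z_i - u_j) tr (q_i o (s o p_j)).
   Positivity of tr (q o P(e + l s) p) for all real l gives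
     tr (q o (s o p))^2 <= tr (q o p) tr (q o P(s) p),
   after which Cauchy-Schwarz with the weights (2 z_i + 4 u_j) / 3 reduces the
   claim to a scalar inequality; no derivative of exp on the algebra is needed.

   Pinsker's inequality yields the usual bound on regret in terms of the
   variation of the payoffs; the Lipschitz bounds and the choice of the stepsize
   make these variations cancel in the sum of both regrets, so that the duality
   gap of the averages is O(1 / T).  Letting T grow along the same run, a
     cluster
   point of the averages is an exact saddle point, which proves the minimax
   theorem for f. *)
Require Import Defs.
From mathcomp Require Import all_boot all_order all_algebra.
From mathcomp Require Import all_classical all_reals all_analysis.
From mathcomp Require Import ring lra complex.

Set Implicit Arguments.
Unset Strict Implicit.
Unset Printing Implicit Defensive.

Import Order.TTheory GRing.Theory Num.Theory.
Import VectorInternalTheory numFieldNormedType.Exports.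

Local Open Scope classical_set_scope.
Local Open Scope ring_scope.

Local Notation "x ** y" := (jmul x y) (at level 40, left associativity).

(** * Power associativity *)

Section jordan_algebra.
Context {R : realType} {J : ejaType R}.
Implicit Types (x y z u v c : J) (a b : R) (p q : {poly R}).

Lemma jmulDl x y z : (x + y) ** z = x ** z + y ** z.
Proof. by have := jmul_linearl z 1 x y; rewrite !scale1r. Qed.

Lemma jmul0x z : 0 ** z = 0.
Proof. by apply: (addIr (0 ** z)); rewrite -jmulDl !add0r. Qed.

Lemma jmulZl a x z : (a *: x) ** z = a *: (x ** z).
Proof. by have := jmul_linearl z a x 0; rewrite /= jmul0x !addr0. Qed.

Lemma jmulNl x z : (- x) ** z = - (x ** z).
Proof. by rewrite -scaleN1r jmulZl scaleN1r. Qed.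

Lemma jmulDr x y z : z ** (x + y) = z ** x + z ** y.
Proof. by rewrite jmulC jmulDl !(jmulC _ z). Qed.

Lemma jmulx0 z : z ** 0 = 0.
Proof. by rewrite jmulC jmul0x. Qed.

Lemma jmulZr a x z : z ** (a *: x) = a *: (z ** x).
Proof. by rewrite jmulC jmulZl jmulC. Qed.

Lemma jmulNr x z : z ** (- x) = - (z ** x).
Proof. by rewrite jmulC jmulNl jmulC. Qed.

Lemma jmulx1 x : x ** jone = x.
Proof. by rewrite jmulC jmul1x. Qed.

Lemma jmul_suml I (r : seq I) (P : pred I) (F : I -> J) z :
  (\sum_(i <- r | P i) F i) ** z = \sum_(i <- r | P i) F i ** z.
Proof. by elim/big_rec2: _ => [|i u v _ <-]; rewrite ?jmul0x ?jmulDl. Qed.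

Lemma jmul_sumr I (r : seq I) (P : pred I) (F : I -> J) z :
  z ** (\sum_(i <- r | P i) F i) = \sum_(i <- r | P i) z ** F i.
Proof. by rewrite jmulC jmul_suml; under eq_bigr do rewrite jmulC. Qed.

Lemma jformDl x y z : jform (x + y) z = jform x z + jform y z.
Proof. by rewrite -[x]scale1r jform_linearl mul1r scale1r. Qed.

Lemma jformZl a x z : jform (a *: x) z = a * jform x z.
Proof. by rewrite -[a *: x]addr0 jform_linearl jform0l addr0. Qed.

Lemma jformNl x z : jform (- x) z = - jform x z.
Proof. by rewrite -scaleN1r jformZl mulN1r. Qed.

Lemma jformDr x y z : jform z (x + y) = jform z x + jform z y.
Proof. by rewrite jformC jformDl !(jformC z). Qed.

Lemma jformZr a x z : jform z (a *: x) = a * jform z x.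
Proof. by rewrite jformC jformZl jformC. Qed.

Lemma jformNr x z : jform z (- x) = - jform z x.
Proof. by rewrite jformC jformNl jformC. Qed.

Lemma jform_suml I (r : seq I) (P : pred I) (F : I -> J) z :
  jform (\sum_(i <- r | P i) F i) z = \sum_(i <- r | P i) jform (F i) z.
Proof. by elim/big_rec2: _ => [|i u v _ <-]; rewrite ?jform0l ?jformDl. Qed.

Lemma jform_self_eq0 x : jform x x = 0 -> x = 0.
Proof.
by have [//|/jform_gt0 + x0] := eqVneq x 0; rewrite x0 ltxx.
Qed.

(** Testing against an arbitrary [u] turns identities of the algebra into real linear ones, which
    [lra] settles from instances of known identities. *)
Lemma jform_ext x y : (forall u, jform x u = jform y u) -> x = y.
Proof.
move=> xy; apply/eqP; rewrite -subr_eq0; apply/eqP/jform_self_eq0.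
by rewrite {1}jformDl jformNl xy subrr.
Qed.

Definition jlinE := (jmulDl, jmulDr, jmulZl, jmulZr, jmulNl, jmulNr, jmul0x,
  jmulx0, jformDl, jformZl, jformNl, @jform0l _ J).

(** This is the part of the Jordan identity at x + z that is linear in z: half the difference
    between the identities at x + z and x - z, less the identity at z. *)
Lemma jordan_linearization x y z :
  (x ** x) ** (z ** y) + 2 *: ((x ** z) ** (x ** y)) =
  z ** ((x ** x) ** y) + 2 *: (x ** ((x ** z) ** y)).
Proof.
apply: jform_ext => u.
have /(congr1 (fun t => jform t u)) := jordan_identity (x + z) y.
have /(congr1 (fun t => jform t u)) := jordan_identity (x - z) y.
have /(congr1 (fun t => jform t u)) := jordan_identity z y.
have /(congr1 (fun t => jform t u)) := jordan_identity x y.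
rewrite !jlinE !(jmulC z x); lra.
Qed.

Lemma jordan_linearization3 x y z w :
  (x ** y) ** (z ** w) + (x ** z) ** (y ** w) + (y ** z) ** (x ** w) =
  x ** ((y ** z) ** w) + y ** ((x ** z) ** w) + z ** ((x ** y) ** w).
Proof.
apply: jform_ext => u.
have /(congr1 (fun t => jform t u)) := jordan_linearization (x + y) w z.
have /(congr1 (fun t => jform t u)) := jordan_linearization x w z.
have /(congr1 (fun t => jform t u)) := jordan_linearization y w z.
rewrite !jlinE !(jmulC y x); lra.
Qed.

Lemma jpowS x n : jpow x n.+1 = x ** jpow x n.
Proof. by []. Qed.

Lemma jpow1 x : jpow x 1 = x.
Proof. by rewrite jpowS jmulx1. Qed.

(* Linearizing the Jordan identity expresses L_{x^(n+2)} as a polynomial in the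
   multiplication operators L_x, L_{x^2}, L_{x^n} and L_{x^(n+1)}. *)
Lemma jpowSS_mul x n y : jpow x n.+2 ** y =
  2 *: (jpow x n.+1 ** (x ** y)) + (x ** x) ** (jpow x n ** y)
  - 2 *: (x ** (jpow x n ** (x ** y))).
Proof.
(* With x^(n+2) written as x^2 o x^n, the claim is the Jordan identity at x and x^n, linearized in
   direction y. *)
suff -> : jpow x n.+2 = (x ** x) ** jpow x n.
  apply: jform_ext => u; rewrite !jpowS.
  have /(congr1 (fun t => jform t u)) := jordan_linearization x (jpow x n) y.
  rewrite !jlinE !(jmulC y) !(jmulC (x ** y)); lra.
elim: n => [|n IHn]; first by rewrite jpowS jpow1 jmulx1.
by rewrite jpowS IHn [in RHS]jpowS jordan_identity.
Qed.

(** The recursion [jpowSS_mul] involves both L_x and L_{x^2}, so the two commutations go through one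
    induction, which needs the two preceding exponents and is therefore strong. Exponent 1 is the
    Jordan identity itself. *)
Lemma jpow_mulC2 x n :
  (forall y, x ** (jpow x n ** y) = jpow x n ** (x ** y)) /\
  (forall y, (x ** x) ** (jpow x n ** y) = jpow x n ** ((x ** x) ** y)).
Proof.
suff : forall m, (m <= n)%N ->
  (forall y, x ** (jpow x m ** y) = jpow x m ** (x ** y)) /\
  (forall y, (x ** x) ** (jpow x m ** y) = jpow x m ** ((x ** x) ** y)).
  exact.
elim: n => [|n IHn] m; first by rewrite leqn0 => /eqP->; split=> y;
  rewrite !jmul1x.
rewrite leq_eqVlt => /predU1P[->|]; last by rewrite ltnS; exact: IHn.
case: n IHn => [|n] IHn; first by rewrite jpow1; split=> y //;
  rewrite jordan_identity.
have [Hx Hx2] := IHn n.+1 (leqnn _).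
have [Gx Gx2] := IHn n (leqnSn _).
by split=> y; rewrite !jpowSS_mul !jlinE !(Hx, Hx2, Gx, Gx2, jordan_identity).
Qed.

Lemma jpowD x m n : jpow x m ** jpow x n = jpow x (m + n).
Proof.
elim: n => [|n IHn]; first by rewrite jmulx1 addn0.
by rewrite jpowS -(jpow_mulC2 x m).1 IHn addnS.
Qed.

Lemma jhornerE n p x : (size p <= n)%N ->
  jhorner p x = \sum_(i < n) p`_i *: jpow x i.
Proof.
move=> pn; rewrite /jhorner (big_ord_widen n (fun i => p`_i *: jpow x i))//.
rewrite big_mkcond; apply: eq_bigr => i _; case: ltnP => // ip.
by rewrite nth_default// scale0r.
Qed.

Lemma jhornerD p q x : jhorner (p + q) x = jhorner p x + jhorner q x.
Proof.
pose n := maxn (size p) (size q).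
rewrite (@jhornerE n)// ?size_polyD// (@jhornerE n p) ?leq_maxl//.
rewrite (@jhornerE n q) ?leq_maxr// -big_split/=.
by apply: eq_bigr => i _; rewrite coefD scalerDl.
Qed.

Lemma jhornerZ a p x : jhorner (a *: p) x = a *: jhorner p x.
Proof.
rewrite (@jhornerE (size p))// ?size_scale_leq// scaler_sumr.
by apply: eq_bigr => i _; rewrite coefZ scalerA.
Qed.

Lemma jhorner0 x : jhorner 0 x = 0.
Proof. by rewrite /jhorner size_poly0 big_ord0. Qed.

Lemma jhornerXn n x : jhorner 'X^n x = jpow x n.
Proof.
rewrite (@jhornerE n.+1)// ?size_polyXn// big_ord_recr/= coefXn eqxx scale1r.
by rewrite big1 ?add0r// => i _; rewrite coefXn ltn_eqF// scale0r.
Qed.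

Lemma jhorner_sum I (r : seq I) (P : pred I) (F : I -> {poly R}) x :
  jhorner (\sum_(i <- r | P i) F i) x = \sum_(i <- r | P i) jhorner (F i) x.
Proof. by elim/big_rec2: _ => [|i u v _ <-]; rewrite ?jhorner0 ?jhornerD. Qed.

Lemma jhorner1 x : jhorner 1 x = jone.
Proof. by rewrite -(expr0 'X) jhornerXn. Qed.

Lemma jhornerC a x : jhorner a%:P x = a *: jone.
Proof. by rewrite -alg_polyC jhornerZ jhorner1. Qed.

Lemma jhornerX x : jhorner 'X x = x.
Proof. by rewrite -(expr1 'X) jhornerXn jpow1. Qed.

Lemma jhornerXsubC a x : jhorner ('X - a%:P) x = x - a *: jone.
Proof. by rewrite -polyCN jhornerD jhornerX jhornerC scaleNr. Qed.

(** By power associativity, divisibility arguments in [{poly R}] carry over to the subalgebra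
    generated by x. *)
Lemma jhornerM p q x : jhorner (p * q) x = jhorner p x ** jhorner q x.
Proof.
have -> : p * q = (\sum_(i < size p) p`_i *: 'X^i) *
    (\sum_(i < size q) q`_i *: 'X^i) by rewrite -!poly_def !coefK.
rewrite mulr_suml jhorner_sum jmul_suml; apply: eq_bigr => i _.
rewrite mulr_sumr jhorner_sum jmul_sumr; apply: eq_bigr => j _.
rewrite -scalerAl -scalerAr !jhornerZ -exprD jhornerXn.
by rewrite jmulZl jmulZr jpowD.
Qed.

End jordan_algebra.

(** * Spectral theorem *)

(** Take a complex root a + ib. If b is nonzero, the remainder of p modulo (X - a)^2 + b^2 is affine
    with real coefficients and vanishes at a + ib, hence is zero. *)
Lemma real_poly_factor (R : rcfType) (p : {poly R}) : (1 < size p)%N ->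
  exists a b, ('X - a%:P) %| p \/
    (b != 0 /\ (('X - a%:P) ^+ 2 + (b ^+ 2)%:P) %| p).
Proof.
move=> p1; pose pC := map_poly (real_complex R) p.
have /closed_rootP[[a b] rz] : size pC != 1 by rewrite size_map_poly gtn_eqF.
exists a, b; have [b0|b0] := eqVneq b 0.
  left; rewrite dvdp_XsubCl.
  move: rz; rewrite b0 -[Complex a 0]/(real_complex R a) /pC /root horner_map.
  by rewrite fmorph_eq0.
right; split=> //; set d := _ + _; apply/modp_eq0P; set r := p %% d.
have dsz : size d = 3.
  rewrite size_polyDl ?size_exp_XsubC// size_polyC.
  by case: eqP.
have rsz : (size r <= 2)%N.
  by have := ltn_modp p d; rewrite -size_poly_gt0 dsz; apply: etrans.
have rE : r = (r`_0)%:P + r`_1 *: 'X.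
  apply/polyP => -[|[|i]];
    rewrite coefD coefC coefZ coefX/= ?mulr0 ?mulr1 ?addr0 ?add0r//.
  by rewrite nth_default// (leq_trans rsz).
have dz : root (map_poly (real_complex R) d) (Complex a b).
  rewrite /root rmorphD rmorphXn/= rmorphB/= map_polyX !map_polyC/= !hornerE.
  by apply/eqP; simpc; congr Complex; ring.
have : root (map_poly (real_complex R) r) (Complex a b).
  move: rz; rewrite /pC {1}(divp_eq p d) rmorphD rmorphM/= /root hornerD
    hornerM.
  by rewrite (eqP dz) mulr0 add0r.
rewrite rE /root rmorphD/= map_polyC map_polyZ map_polyX/= !hornerE.
simpc; rewrite eq_complex/= => /andP[+ /eqP/eqP].
rewrite mulf_eq0 (negbTE b0) orbF => + /eqP r1.
by rewrite r1 mul0r addr0 => /eqP ->; rewrite scale0r addr0.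
Qed.

Lemma poly_interpolation (F : fieldType) (s : seq F) (g : F -> F) : uniq s ->
  exists p : {poly F}, forall b, b \in s -> p.[b] = g b.
Proof.
elim: s => [|a s IHs]/=; first by exists 0.
move=> /andP[aNs /IHs[p pg]].
pose w := \prod_(b <- s) ('X - b%:P).
have wa : w.[a] != 0 by rewrite -rootE root_prod_XsubC.
exists (p + ((g a - p.[a]) / w.[a]) *: w) => b; rewrite inE => /predU1P[->|bs].
  by rewrite hornerD hornerZ divfK// addrC subrK.
have /eqP wb : root w b by rewrite root_prod_XsubC.
by rewrite hornerD hornerZ wb mulr0 addr0 pg.
Qed.

Section spectral_theorem.
Context {R : realType} {J : ejaType R}.
Implicit Types (x y z u v c : J) (a b : R) (p q : {poly R}).

Lemma jhorner_split p q x : p != 0 -> jhorner (p * q) x = 0 ->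
  exists2 s : seq R, uniq s & jhorner (\prod_(a <- s) ('X - a%:P) * q) x = 0.
Proof.
have [n] := ubnP (size p); elim: n => // n IHn in p q * => pn p0 pq0.
have [p1|p1] := leqP (size p) 1.
  exists [::] => //; rewrite big_nil mul1r.
  move: p0 pq0; rewrite (size1_polyC p1) polyC_eq0 => p0.
  rewrite mul_polyC jhornerZ => /eqP; rewrite scaler_eq0 (negbTE p0) => /eqP//.
have [a [b [/dvdpP[r pE]|[b0 /dvdpP[r pE]]]]] := real_poly_factor p1.
  have r0 : r != 0 by apply: contra_neq p0; rewrite pE => ->; rewrite mul0r.
  have rn : (size r < n)%N.
    by rewrite -ltnS (leq_trans _ pn)// pE size_Mmonic ?monicXsubC// size_XsubC
      addn2.
  have := IHn r (('X - a%:P) * q) rn r0; rewrite mulrA -pE => /(_ pq0)[s us].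
  have [sa|sa] := boolP (a \in s); last first.
    move=> sq; exists (a :: s); first by rewrite /= sa us.
    by rewrite big_cons -mulrA mulrCA.
  rewrite mulrCA => sq; exists s => //.
  move: sq; rewrite (perm_big _ (perm_to_rem sa)) big_cons/=.
  set t := \prod_(_ <- _) _ => sq; apply: jform_self_eq0.
  rewrite -{1}mulrA jhornerM jformA -jhornerM -!mulrA.
  by move: sq; rewrite -!mulrA => ->; rewrite jformC jform0l.
have r0 : r != 0 by apply: contra_neq p0; rewrite pE => ->; rewrite mul0r.
have dsz : size (('X - a%:P) ^+ 2 + (b ^+ 2)%:P) = 3.
  by rewrite size_polyDl ?size_exp_XsubC// size_polyC; case: eqP.
have rn : (size r < n)%N.
  rewrite -ltnS (leq_trans _ pn)// pE size_mul// -?size_poly_gt0 ?dsz//.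
  by rewrite addn3.
apply: (IHn r) => //; apply: jform_self_eq0.
set w := jhorner _ x; pose v := x - a *: jone.
have : jform (v ** (v ** w) + b ^+ 2 *: w) w = 0.
  rewrite -[RHS](jform0l w) -pq0 pE; congr jform.
  rewrite /v /w -jhornerXsubC -!jhornerM -jhornerZ -jhornerD; congr jhorner.
  by rewrite mulrAC -mul_polyC; ring.
rewrite jformDl jformZl jformA => /eqP.
rewrite paddr_eq0 ?jform_ge0//; last by rewrite mulr_ge0 ?sqr_ge0// jform_ge0.
by move=> /andP[_]; rewrite mulf_eq0 sqrf_eq0 (negbTE b0) => /eqP.
Qed.

End spectral_theorem.

(** * Peirce decomposition with respect to an idempotent *)

Section peirce.
Context {R : realType} {J : ejaType R}.
Implicit Types (x y z u v c h : J) (a b : R) (p q : {poly R}).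

(** L_c is annihilated by 2t^3 - 3t^2 + t = t (2t - 1) (t - 1), so its eigenvalues lie in {0, 1/2,
    1}. *)
Lemma peirce_cubic c x : c ** c = c ->
  2 *: (c ** (c ** (c ** x))) + c ** x = 3 *: (c ** (c ** x)).
Proof.
move=> cc; apply: jform_ext => u.
have /(congr1 (fun t => jform t u)) := jordan_linearization c c x.
rewrite !jlinE !cc !(jmulC x) !(jmulC (c ** x)); lra.
Qed.

Lemma peirce_linearization c y z : c ** c = c ->
  c ** (z ** y) + 2 *: ((c ** z) ** (c ** y)) =
  z ** (c ** y) + 2 *: (c ** ((c ** z) ** y)).
Proof. by move=> cc; have := jordan_linearization c y z; rewrite cc. Qed.

(** In the names of the product rules, 0, 1 and h are the Peirce eigenvalues of the factors, with h
    for 1/2. *)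
Lemma peirce00 c x y : c ** c = c -> c ** x = 0 -> c ** y = 0 ->
  c ** (x ** y) = 0.
Proof.
move=> cc cx cy; have := peirce_linearization y x cc.
by rewrite cx cy !jmulx0 jmul0x jmulx0 scaler0 !addr0.
Qed.

Lemma peirce10 c x y : c ** c = c -> c ** x = x -> c ** y = 0 -> x ** y = 0.
Proof.
move=> cc cx cy; apply: jform_ext => u.
have /(congr1 (fun t => jform t u)) := peirce_linearization y x cc.
have /(congr1 (fun t => jform t u)) := peirce_linearization x y cc.
rewrite cx cy (jmulC y) !jlinE; lra.
Qed.

Lemma peirce0h c x h : c ** c = c -> c ** x = 0 -> c ** h = 2^-1 *: h ->
  c ** (x ** h) = 2^-1 *: (x ** h).
Proof.
move=> cc cx ch; have := peirce_linearization h x cc.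
by rewrite cx ch !jlinE scaler0 !addr0.
Qed.

Lemma peircehh c h : c ** c = c -> c ** h = 2^-1 *: h ->
  c ** (c ** (h ** h)) = c ** (h ** h).
Proof.
move=> cc ch; apply: jform_ext => u.
have /(congr1 (fun t => jform t u)) := jordan_linearization3 c h h c.
rewrite !(jmulC h c) ch cc !jlinE !(jmulC h c) ch !(jmulC (h ** h)) !jlinE; lra.
Qed.

(* The eigenvalues 0, 1/2, 1 of L_c satisfy
   t = (t (2 t - 1))^2 + 8 (t (1 - t))^2. *)
Lemma idempotent_form_sos c x : c ** c = c -> jform (c ** x) x =
  jform (2 *: (c ** (c ** x)) - c ** x) (2 *: (c ** (c ** x)) - c ** x) +
  8 * jform (c ** x - c ** (c ** x)) (c ** x - c ** (c ** x)).
Proof.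
move=> cc.
have H : c ** (c ** (c ** x)) = 2^-1 *: (3 *: (c ** (c ** x)) - c ** x).
  by rewrite -(peirce_cubic x cc) addrK scalerA mulVf// scale1r.
have E3 : jform (c ** (c ** x)) (c ** x) = jform (c ** (c ** (c ** x))) x.
  by rewrite [LHS]jformA [LHS]jformA jformC.
have E4 : jform (c ** (c ** x)) (c ** (c ** x)) =
    jform (c ** (c ** (c ** (c ** x)))) x.
  by rewrite [LHS]jformA [LHS]jformA jformC.
have E2 : jform (c ** x) (c ** x) = jform (c ** (c ** x)) x.
  by rewrite jformA jformC.
move: E2 E3 E4; rewrite !jlinE ![jform _ (_ + _)]jformDr.
rewrite ![jform _ (_ *: _)]jformZr ![jform _ (- _)]jformNr.
rewrite [jform (c ** x) (c ** (c ** x))]jformC => -> -> ->.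
rewrite !H !jlinE !H !jlinE; lra.
Qed.

Lemma idempotent_form_ge0 c x : c ** c = c -> 0 <= jform (c ** x) x.
Proof.
by move=> cc; rewrite idempotent_form_sos// addr_ge0 ?mulr_ge0 ?jform_ge0.
Qed.

(** Both squares of [idempotent_form_sos] vanish, so c o x equals both c o (c o x) and twice it. *)
Lemma idempotent_form_eq0 c x :
  c ** c = c -> jform (c ** x) x = 0 -> c ** x = 0.
Proof.
move=> cc /eqP; rewrite idempotent_form_sos// paddr_eq0 ?mulr_ge0 ?jform_ge0//.
move=> /andP[/eqP/jform_self_eq0 H1]; rewrite mulf_eq0 pnatr_eq0/=.
move=> /eqP/jform_self_eq0/subr0_eq H2; move: H1; rewrite -H2 scaler_nat mulr2n.
by rewrite addrK.
Qed.

End peirce.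

(** * Orthogonal systems of idempotents and existence of spectral decompositions *)

Section orthogonal_systems.
Context {R : realType} {J : ejaType R}.
Implicit Types (x y z u v c h : J) (a b : R) (p q : {poly R}).

Lemma leq_dim_free n (q : 'I_n -> J) :
  (forall l : 'I_n -> R, \sum_i l i *: q i = 0 -> forall i, l i = 0) ->
  (n <= dim J)%N.
Proof.
move=> free_q; pose M := \matrix_(i < n) v2r (q i).
suff : row_free M by rewrite /row_free => /eqP <-; exact: rank_leq_col.
rewrite -kermx_eq0; apply/eqP/row_matrixP => k.
apply/rowP => i; rewrite row0 [RHS]mxE.
have /row_matrixP/(_ k) := mulmx_ker M; rewrite row0 row_mul.
set w := row k _; move=> wM; apply: (free_q (fun j => w ord0 j)).
apply: (can_inj v2rK); rewrite linear0 -wM mulmx_sum_row linear_sum.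
by apply: eq_bigr => j _; rewrite linearZ rowK.
Qed.

(** The powers of x with exponents 0 to [dim J] are one too many to be linearly independent. *)
Lemma annihilating_poly x : exists2 p : {poly R}, p != 0 & jhorner p x = 0.
Proof.
apply: contrapT => Hp.
suff : ((dim J).+1 <= dim J)%N by rewrite ltnn.
apply: (@leq_dim_free _ (fun i => jpow x i)) => l l0 i.
pose p := \poly_(i < (dim J).+1) l (inord i).
have pl j : p`_(nat_of_ord (j : 'I_(dim J).+1)) = l j.
  by rewrite coef_poly ltn_ord inord_val.
rewrite -pl; suff -> : p = 0 by rewrite coef0.
apply: contrapT => /eqP p0; apply: Hp; exists p => //.
by rewrite (@jhornerE _ _ (dim J).+1) ?size_poly// -[RHS]l0;
  apply: eq_bigr => j _; rewrite pl.
Qed.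

Definition orthogonal_system n (q : 'I_n -> J) :=
  [/\ forall i, q i != 0, forall i, q i ** q i = q i,
      forall i j, i != j -> q i ** q j = 0 & \sum_i q i = jone].

Lemma orthogonal_system_mul n (q : 'I_n -> J) (l : 'I_n -> R) k :
  orthogonal_system q -> q k ** (\sum_i l i *: q i) = l k *: q k.
Proof.
move=> [_ qq qo _]; rewrite jmul_sumr (bigD1 k)//= jmulZr qq big1 ?addr0//.
by move=> i ik; rewrite jmulZr qo 1?eq_sym// scaler0.
Qed.

Lemma orthogonal_system_free n (q : 'I_n -> J) (l m : 'I_n -> R) :
  orthogonal_system q -> \sum_i l i *: q i = \sum_i m i *: q i -> l =1 m.
Proof.
move=> Hq lm i; have [q0 _ _ _] := Hq.
have := orthogonal_system_mul l i Hq.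
rewrite lm (orthogonal_system_mul _ _ Hq) => /eqP.
rewrite -subr_eq0 -scalerBl scaler_eq0 (negbTE (q0 i)) orbF subr_eq0.
by move=> /eqP.
Qed.

Lemma orthogonal_system_jmul n (q : 'I_n -> J) (l m : 'I_n -> R) :
  orthogonal_system q ->
  (\sum_i l i *: q i) ** (\sum_i m i *: q i) = \sum_i (l i * m i) *: q i.
Proof.
move=> Hq; rewrite jmul_suml; apply: eq_bigr => i _.
by rewrite jmulZl (orthogonal_system_mul _ _ Hq) scalerA.
Qed.

Lemma orthogonal_system_jpow n (q : 'I_n -> J) (l : 'I_n -> R) k :
  orthogonal_system q ->
  jpow (\sum_i l i *: q i) k = \sum_i (l i ^+ k) *: q i.
Proof.
move=> Hq; elim: k => [|k IHk].
  have [_ _ _ q1] := Hq; rewrite -[LHS]/jone -q1.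
  by apply: eq_bigr => i _; rewrite expr0 scale1r.
by rewrite jpowS IHk orthogonal_system_jmul//; apply: eq_bigr => i _;
  rewrite exprS.
Qed.

Lemma orthogonal_system_jhorner n (q : 'I_n -> J) (l : 'I_n -> R) p :
  orthogonal_system q ->
  jhorner p (\sum_i l i *: q i) = \sum_i p.[l i] *: q i.
Proof.
move=> Hq; rewrite /jhorner; under eq_bigr => k _ do
  rewrite (orthogonal_system_jpow _ _ Hq) scaler_sumr.
rewrite exchange_big/=; apply: eq_bigr => i _.
by rewrite horner_coef scaler_suml; apply: eq_bigr => k _; rewrite scalerA.
Qed.

Lemma orthogonal_system_dim n (q : 'I_n -> J) :
  orthogonal_system q -> (n <= dim J)%N.
Proof.
move=> Hq; apply: (@leq_dim_free _ q) => l l0.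
apply: (orthogonal_system_free (m := fun=> 0) Hq).
by rewrite l0 big1// => i _; rewrite scale0r.
Qed.

(** The idempotents are the Lagrange interpolation polynomials at the roots of a split annihilator,
    evaluated at x. *)
Lemma orthogonal_decomposition x : exists n (q : 'I_n -> J) (l : 'I_n -> R),
  orthogonal_system q /\ x = \sum_i l i *: q i.
Proof.
have [p p0 px] := annihilating_poly x.
have [s us] : exists2 s : seq R, uniq s &
    jhorner (\prod_(a <- s) ('X - a%:P)) x = 0.
  have [|s us sx] := @jhorner_split _ _ p 1 x p0; first by rewrite mulr1.
  by exists s; rewrite // -[\prod_(a <- s) _]mulr1.
move=> sx.
(* Evaluation at x depends only on the values on s: two polynomials that agree there differ by a
   multiple of the annihilator. *)
have agree (u v : {poly R}) : (forall b, b \in s -> u.[b] = v.[b]) ->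
    jhorner u x = jhorner v x.
  move=> uv; have /dvdpP[w uvE] : \prod_(a <- s) ('X - a%:P) %| u - v.
    apply: uniq_roots_dvdp; last by rewrite uniq_rootsE.
    by apply/allP => b bs; rewrite /root !hornerE uv// subrr.
  by rewrite -(subrK v u) uvE jhornerD jhornerM sx jmulx0 add0r.
have /choice[L LE] (i : 'I_(size s)) : exists L : {poly R},
    forall b, b \in s -> L.[b] = (b == s`_i)%:R.
  by have [L] := poly_interpolation (fun b => (b == s`_i)%:R) us; exists L.
pose c (i : 'I_(size s)) := jhorner (L i) x.
have cc i j : c i ** c j = if i == j then c i else 0.
  rewrite /c -jhornerM; transitivity (jhorner (if i == j then L i else 0) x).
    apply: agree => b bs; rewrite hornerM !LE//.
    have [<-|ij] := eqVneq i j; first by rewrite LE//; case: eqP;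
      rewrite ?mulr1 ?mulr0.
    rewrite horner0; case: eqP => [->|]; last by rewrite mul0r.
    by rewrite nth_uniq// val_eqE (negbTE ij) mulr0.
  by case: eqP => // _; rewrite jhorner0.
have sumL b : b \in s -> forall g : R -> R,
    \sum_(i < size s) g s`_i * (L i).[b] = g b.
  move=> bs g; have bi : (index b s < size s)%N by rewrite index_mem.
  rewrite (bigD1 (Ordinal bi))//= LE// nth_index// eqxx mulr1 big1 ?addr0// =>
    i ib.
  rewrite LE//; case: eqP => [bE|]; last by rewrite mulr0.
  by move: ib; rewrite -val_eqE/= bE index_uniq ?eqxx.
have sumc : \sum_i c i = jone.
  rewrite -jhorner_sum -(jhorner1 x); apply: agree => b bs.
  by rewrite horner_sum hornerC -[RHS](sumL b bs (fun=> 1));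
    apply: eq_bigr => i _; rewrite mul1r.
have sumac : \sum_(i < size s) s`_i *: c i = x.
  transitivity (jhorner (\sum_(i < size s) s`_i *: L i) x).
    by rewrite jhorner_sum; under [RHS]eq_bigr do rewrite jhornerZ.
  rewrite -[RHS](jhornerX x); apply: agree => b bs.
  by rewrite horner_sum hornerX -[RHS](sumL b bs id); apply: eq_bigr => i _;
    rewrite hornerZ.
(* A root in s need not be an eigenvalue of x; the idempotents of such roots are zero and are
   discarded. *)
pose A := [pred i : 'I_(size s) | c i != 0].
exists #|A|, (fun k => c (enum_val k)), (fun k =>
  s`_(enum_val k : 'I_(size s))).
have sumA (F : 'I_(size s) -> R) : \sum_i F i *: c i =
    \sum_(k < #|A|) F (enum_val k) *: c (enum_val k).
  rewrite -(@big_enum_val _ _ _ _ A (fun i => F i *: c i))/= [RHS]big_mkcond.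
  apply: eq_bigr => i _; rewrite inE.
  by case: eqP => //= ->; rewrite scaler0.
split; last by rewrite -(sumA (fun i => s`_i)).
split=> [k|k|k l kl|].
- by have := enum_valP k; rewrite inE.
- by rewrite cc eqxx.
- by rewrite cc (inj_eq enum_val_inj) (negbTE kl).
- rewrite -sumc; have := sumA (fun=> 1).
  by under eq_bigr do rewrite scale1r;
    under [X in _ = X]eq_bigr do rewrite scale1r.
Qed.

Lemma idempotent_sum_orth u v : u ** u = u -> v ** v = v ->
  (u + v) ** (u + v) = u + v -> u ** v = 0.
Proof.
move=> uu vv; rewrite !jmulDl !jmulDr uu vv (jmulC v) => H.
apply: jform_ext => w.
by move: H => /(congr1 (fun t => jform t w)); rewrite !jlinE; lra.
Qed.

(** Position 0 receives u, and v takes over the old place of [q k]. Both lie in the Peirce 1-space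
    of [q k] and the other members in its 0-space, hence orthogonality. *)
Lemma orthogonal_system_split n (q : 'I_n -> J) k u v : orthogonal_system q ->
  u <> 0 -> v <> 0 -> idempotent_elt u -> idempotent_elt v -> q k = u + v ->
  orthogonal_system (fun i : 'I_n.+1 =>
    if unlift ord0 i is Some j then if j == k then v else q j else u).
Proof.
move=> [q0 qq qo q1] /eqP u0 /eqP v0 uu vv quv.
have uv : u ** v = 0 by apply: idempotent_sum_orth => //; rewrite -quv.
have qu : q k ** u = u by rewrite quv jmulDl uu jmulC uv addr0.
have qv : q k ** v = v by rewrite quv jmulDl uv vv add0r.
have uq j : j != k -> u ** q j = 0.
  by move=> jk; apply: (peirce10 (qq k) qu); rewrite qo// eq_sym.
have vq j : j != k -> v ** q j = 0.
  by move=> jk; apply: (peirce10 (qq k) qv); rewrite qo// eq_sym.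
split=> [i|i|i j|].
- by case: (unliftP ord0 i) => [j _|_] //; case: (j =P k) => _; rewrite ?v0 ?q0.
- by case: (unliftP ord0 i) => [j _|_] //; case: (j =P k) => _; rewrite ?vv ?qq.
- case: (unliftP ord0 i) => [i' ->|->];
  case: (unliftP ord0 j) => [j' ->|->] ij //.
  + have ij' : i' != j' by apply: contra_neq ij => ->.
    case: eqP => ik; case: eqP => jk; last by rewrite qo.
    * by move: ij'; rewrite ik jk eqxx.
    * by rewrite vq//; apply/eqP.
    * by rewrite jmulC vq//; apply/eqP.
  + by case: eqP => ik; rewrite jmulC ?uv// uq//; apply/eqP.
  + by case: eqP => ik; rewrite ?uv// uq//; apply/eqP.
- rewrite big_ord_recl unlift_none -q1.
  under eq_bigr do rewrite liftK.
  rewrite (bigD1 k)//= eqxx [RHS](bigD1 k)//= addrA quv; congr (_ + _).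
  by apply: eq_bigr => i /negbTE->.
Qed.

(** Among the decompositions of x, whose lengths are bounded by the dimension, take a longest one: a
    member that is not primitive could be split, repeating its eigenvalue on both pieces. *)
Theorem primitive_decomposition x : exists n (q : 'I_n -> J) (l : 'I_n -> R),
  [/\ orthogonal_system q, forall i, primitive_idempotent (q i) &
      x = \sum_i l i *: q i].
Proof.
pose P n := `[< exists (q : 'I_n -> J) (l : 'I_n -> R),
  orthogonal_system q /\ x = \sum_i l i *: q i >].
have Pex : exists n, P n.
  by have [n [q [l H]]] := orthogonal_decomposition x; exists n; apply/asboolP;
    exists q, l.
have Pub n : P n -> (n <= dim J)%N.
  by move=> /asboolP[q [l [Hq _]]]; exact: orthogonal_system_dim Hq.
case: (ex_maxnP Pex Pub) => n /asboolP[q [l [Hq xE]]] nmax.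
exists n, q, l; split=> // k; have [q0 qq qo q1] := Hq.
split; [exact/eqP|exact: qq|] => -[u [v [u0 v0 uu vv quv]]].
have := orthogonal_system_split Hq u0 v0 uu vv quv.
set q' := fun _ => _ => Hq'.
suff : P n.+1 by move=> /nmax; rewrite ltnn.
apply/asboolP; exists q', (fun i =>
  if unlift ord0 i is Some j then l j else l k).
split=> //; rewrite xE big_ord_recl /q' unlift_none.
under [in RHS]eq_bigr do rewrite liftK.
rewrite (bigD1 k)//= [in RHS](bigD1 k)//= eqxx addrA quv scalerDr;
  congr (_ + _).
by apply: eq_bigr => i /negbTE->.
Qed.

End orthogonal_systems.

(** * Trace *)

Section trace_form.
Context {R : realType} {J : ejaType R}.
Implicit Types (x y z u v c d h : J) (a b : R) (p q : {poly R}).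

Lemma primitive_idem c : primitive_idempotent c -> c ** c = c.
Proof. by case. Qed.

Lemma primitive_form_gt0 c : primitive_idempotent c -> 0 < jform c c.
Proof. by move=> [/eqP c0 _ _]; exact: jform_gt0. Qed.

(** Each spectral idempotent q of x with nonzero eigenvalue satisfies q o c = q, so c = q + (c - q)
    splits c unless q = c. *)
Lemma primitive_peirce1 c x : primitive_idempotent c -> c ** x = x ->
  exists a, x = a *: c.
Proof.
move=> [c0 cc cprim] cx.
have [n [q [l [[q0 qq qo q1] xE]]]] := orthogonal_decomposition x.
exists (\sum_i l i); rewrite xE scaler_suml; apply: eq_bigr => i _.
have [->|li0] := eqVneq (l i) 0; first by rewrite !scale0r.
congr (_ *: _).
have qix : x ** q i = l i *: q i.
  by rewrite xE jmulC orthogonal_system_mul.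
have cqi0 : q i ** (jone - c) = 0.
  apply: idempotent_form_eq0 => //; apply: (mulfI li0); rewrite mulr0.
  rewrite -jformZl -jmulZl -qix jmulC jformC.
  have e : (jone - c) ** (jone - c) = jone - c.
    by rewrite jmulDl jmul1x jmulNl jmulDr jmulx1 jmulNr cc subrr oppr0 addr0.
  have -> : jform (jone - c) ((jone - c) ** (x ** q i)) = jform (x ** (jone -
    c)) (q i).
    by rewrite -jformA e jformC jformA jformC.
  by rewrite jmulDr jmulNr jmulx1 (jmulC x) cx subrr jform0l.
have cqi : q i ** c = q i.
  by move: cqi0; rewrite jmulDr jmulNr jmulx1 => /eqP; rewrite subr_eq0 => /eqP.
apply: contrapT => /eqP qic; apply: cprim; exists (q i), (c - q i).
split; [exact/eqP|apply/eqP; rewrite subr_eq0 eq_sym//|exact: qq| |].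
  rewrite /idempotent_elt !jlinE cc (jmulC c) cqi qq.
  by rewrite subrr addr0.
by rewrite addrC subrK.
Qed.

(** P(c) x lies in the Peirce 1-space by the cubic relation, hence is a multiple of c; pairing with
    c gives the factor. *)
Lemma primitive_quad c x : primitive_idempotent c ->
  2 *: (c ** (c ** x)) - c ** x = (jform x c / jform c c) *: c.
Proof.
move=> cP; have cc := primitive_idem cP.
have [|a E] := @primitive_peirce1 c (2 *: (c ** (c ** x)) - c ** x) cP.
  apply: jform_ext => u.
  have /(congr1 (fun t => jform t u)) := peirce_cubic x cc.
  rewrite !jlinE; lra.
rewrite E; congr (_ *: _).
have /(congr1 (fun t => jform t c)) := E; rewrite !jlinE !jformA !cc.
have /gt_eqF/negbT mu0 := primitive_form_gt0 cP.
move=> H; have -> : jform x c = a * jform c c by lra.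
by rewrite mulfK.
Qed.

(** The numbers jform (P(c) d) d and jform (P(d) c) c both equal 2 jform (c o d) (c o d) - jform c
    d, whereas [primitive_quad] evaluates them as the square of jform c d over jform c c and over
    jform d d respectively. *)
Lemma primitive_form_eq c d :
  primitive_idempotent c -> primitive_idempotent d ->
  jform c d != 0 -> jform c c = jform d d.
Proof.
move=> cP dP cd0; have cc := primitive_idem cP; have dd := primitive_idem dP.
have N1 : jform (c ** (c ** d)) d = jform (c ** d) (c ** d) by rewrite jformA.
have N2 : jform (d ** (d ** c)) c = jform (c ** d) (c ** d).
  by rewrite jformA (jmulC d).
have N3 : jform (c ** d) d = jform c d by rewrite (jmulC c) jformA dd.
have N4 : jform (d ** c) c = jform c d by rewrite (jmulC d) jformA cc jformC.
have /(congr1 (fun t => jform t d)) := primitive_quad d cP.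
have /(congr1 (fun t => jform t c)) := primitive_quad c dP.
rewrite !jlinE N1 N2 N3 N4 (jformC d c) => -> H.
apply: invr_inj; apply: (mulfI cd0); apply: (mulIf cd0); exact/esym.
Qed.

Lemma primitive_orth c d : primitive_idempotent c -> primitive_idempotent d ->
  jform c d = 0 -> c ** d = 0.
Proof.
move=> /primitive_idem cc /primitive_idem dd cd0.
by apply: idempotent_form_eq0; rewrite // jmulC jformA dd.
Qed.

(** The witness is built from one frame. Against a primitive d, each member of the frame is either
    orthogonal to d or has the same norm as d, so the weights can be pulled out as that of d. This z
    represents the trace through [jform], as [jtrE] shows. *)
Lemma trace_weight_exists : exists z : J,
  forall d, primitive_idempotent d -> z ** d = (jform d d)^-1 *: d.
Proof.
have [n [q [_ [[_ qq qo q1] qP _]]]] := primitive_decomposition (0 : J).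
exists (\sum_i (jform (q i) (q i))^-1 *: q i) => d dP.
transitivity ((jform d d)^-1 *: (jone ** d)); last by rewrite jmul1x.
rewrite -q1 !jmul_suml scaler_sumr; apply: eq_bigr => i _.
rewrite jmulZl; have [qd0|qd0] := eqVneq (jform (q i) d) 0.
  by rewrite (primitive_orth (qP i) dP qd0) !scaler0.
by rewrite (primitive_form_eq (qP i) dP qd0).
Qed.

Definition trace_weight : J := xget 0 [set z : J |
  forall d, primitive_idempotent d -> z ** d = (jform d d)^-1 *: d].

Lemma trace_weightP d : primitive_idempotent d ->
  trace_weight ** d = (jform d d)^-1 *: d.
Proof.
by move: d; exact: (xgetPex (0 : J) trace_weight_exists).
Qed.

(** By linearity x may be a primitive idempotent c; the weight maps c to a multiple of c, and in the
    linearized Jordan identity at c, c and the weight the remaining terms cancel. This yields the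
    associativity of the trace. *)
Lemma trace_weight_central x y :
  trace_weight ** (x ** y) = x ** (trace_weight ** y).
Proof.
have [n [q [l [_ qP ->]]]] := primitive_decomposition x.
rewrite !jmul_suml jmul_sumr; apply: eq_bigr => i _.
rewrite !jmulZl jmulZr; congr (_ *: _); set z := trace_weight.
have cc := primitive_idem (qP i); move: (trace_weightP (qP i)).
rewrite -/z; move: cc; move: (q i) (_^-1) => c a cc zc.
apply: jform_ext => u.
have /(congr1 (fun t => jform t u)) := jordan_linearization3 c c z y.
rewrite cc (jmulC c z) zc !jlinE; lra.
Qed.

Lemma form_weight_primitive d : primitive_idempotent d ->
  jform d trace_weight = 1.
Proof.
move=> dP; rewrite -(primitive_idem dP) jformA jmulC trace_weightP// jformZr.
by rewrite mulVf// gt_eqF// primitive_form_gt0.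
Qed.

Lemma primitive_system_size n (q : 'I_n -> J) : orthogonal_system q ->
  (forall i, primitive_idempotent (q i)) -> n%:R = jform jone trace_weight.
Proof.
move=> [_ _ _ <-] qP; rewrite jform_suml.
under eq_bigr do rewrite form_weight_primitive//.
by rewrite big_const_ord iter_addr addr0.
Qed.

(** By [primitive_system_size] all primitive systems have the same length n, so every element is
    annihilated by a product of n linear factors; an element with n distinct eigenvalues attains
    degree n. *)
Lemma primitive_system_rank n (q : 'I_n -> J) : orthogonal_system q ->
  (forall i, primitive_idempotent (q i)) -> rank J = n.
Proof.
move=> Hq qP; rewrite /rank; set A := [set k : nat | _].
suff [An nub] : is_max A n.
  apply: xget_unique => // r [rA rub]; apply/eqP; rewrite eq_le.
  by rewrite nub// rub.
split.
    (* The eigenvalues 0, ..., n - 1 are pairwise distinct, so a polynomial killing x has n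
       roots. *)
    pose x := \sum_i (nat_of_ord i)%:R *: q i.
    pose s : seq R := [seq (nat_of_ord i)%:R | i <- enum 'I_n].
    have us : uniq s.
      rewrite map_inj_uniq ?enum_uniq// => i j /eqP; rewrite eqr_nat => /eqP.
      exact: val_inj.
    have ss : size s = n by rewrite size_map size_enum_ord.
    exists x, (\prod_(a <- s) ('X - a%:P)); split; last first.
      by rewrite size_prod_XsubC ss.
    split; first exact: monic_prod_XsubC.
      rewrite orthogonal_system_jhorner// big1// => i _.
      have /eqP -> : root (\prod_(a <- s) ('X - a%:P)) i%:R.
        by rewrite root_prod_XsubC; apply/map_f; rewrite mem_enum.
      by rewrite scale0r.
    move=> p p0 px0; rewrite size_prod_XsubC ss ltnNge;
      apply: contraNN p0 => sp.
    apply/eqP; apply: (@roots_geq_poly_eq0 _ _ s) => //; last by rewrite ss.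
    apply/allP => _ /mapP[i _ ->]; apply/eqP.
    move: px0; rewrite orthogonal_system_jhorner//.
    move=> px0; apply: (orthogonal_system_free
      (l := fun i : 'I_n => p.[i%:R]) (m := fun=> 0) Hq).
    by rewrite px0 big1// => j _; rewrite scale0r.
  move=> _ /= [x [p [[_ _ pmin] ->]]].
  have [m [q' [l [Hq' qP' xE]]]] := primitive_decomposition x.
  have mn : m = n.
    apply/eqP; rewrite -(eqr_nat R) (primitive_system_size Hq qP).
    by rewrite (primitive_system_size Hq' qP').
  pose s : seq R := [seq l i | i <- enum 'I_m].
  have /pmin : \prod_(a <- s) ('X - a%:P) != 0 by rewrite monic_neq0//
    monic_prod_XsubC.
  rewrite size_prod_XsubC size_map size_enum_ord mn xE
    orthogonal_system_jhorner//.
  rewrite big1 => [/(_ erefl)|i _]; first by case: (size p).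
  have /eqP -> : root (\prod_(a <- s) ('X - a%:P)) (l i).
    by rewrite root_prod_XsubC; apply/map_f; rewrite mem_enum.
  by rewrite scale0r.
Qed.

Lemma spectralP x : spectral_decomposition x (spectral x).
Proof.
rewrite /spectral; apply: xgetPex.
have [n [q [l [Hq qP xE]]]] := primitive_decomposition x.
have nE := primitive_system_rank Hq qP; move: q l Hq qP xE; rewrite -nE => q l.
move=> [q0 qq qo q1] qP xE; exists ([ffun i => l i], [ffun i => q i]) => /=.
split; last by rewrite xE; apply: eq_bigr => i _; rewrite !ffunE.
split=> [i|i j ij|]; rewrite ?ffunE//=.
- exact: qo.
- by rewrite -q1; apply: eq_bigr => i _; rewrite !ffunE.
Qed.

Lemma eigproj_primitive x i : primitive_idempotent (eigproj x i).
Proof. by have [[qP _ _] _] := spectralP x; exact: qP. Qed.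

Lemma eigproj_system x : orthogonal_system (eigproj x).
Proof.
have [[qP qo q1] _] := spectralP x; split=> // i; first by have [/eqP] := qP i.
exact: primitive_idem (qP i).
Qed.

Lemma spectralE x : x = \sum_i eigval x i *: eigproj x i.
Proof. by have [_ xE] := spectralP x. Qed.

Lemma eigproj_sum x : \sum_i eigproj x i = jone.
Proof. by have [_ _ _ ->] := eigproj_system x. Qed.

(** The right-hand side is linear and does not mention the chosen decomposition, so [jtr] is linear
    and independent of that choice. *)
Lemma jtrE x : jtr x = jform x trace_weight.
Proof.
rewrite [in RHS](spectralE x) jform_suml; apply: eq_bigr => i _.
by rewrite jformZl form_weight_primitive ?mulr1//; exact: eigproj_primitive.
Qed.

Lemma jtrD x y : jtr (x + y) = jtr x + jtr y.
Proof. by rewrite !jtrE jformDl. Qed.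

Lemma jtrZ a x : jtr (a *: x) = a * jtr x.
Proof. by rewrite !jtrE jformZl. Qed.

Lemma jtrN x : jtr (- x) = - jtr x.
Proof. by rewrite !jtrE jformNl. Qed.

Lemma jtrB x y : jtr (x - y) = jtr x - jtr y.
Proof. by rewrite jtrD jtrN. Qed.

Lemma jtr0 : jtr (0 : J) = 0.
Proof. by rewrite jtrE jform0l. Qed.

Lemma jtr_sum I (r : seq I) (P : pred I) (F : I -> J) :
  jtr (\sum_(i <- r | P i) F i) = \sum_(i <- r | P i) jtr (F i).
Proof. by rewrite jtrE jform_suml; apply: eq_bigr => i _; rewrite jtrE. Qed.

Lemma jtr_primitive c : primitive_idempotent c -> jtr c = 1.
Proof. by move=> cP; rewrite jtrE form_weight_primitive. Qed.

Lemma jtr1 : jtr (jone : J) = (rank J)%:R.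
Proof.
rewrite -(eigproj_sum 0) jtr_sum (eq_bigr (fun=> 1)) => [|i _].
  by rewrite big_const_ord iter_addr addr0.
by rewrite jtr_primitive//; exact: eigproj_primitive.
Qed.

Lemma rank_gt0 : (0 < rank J)%N.
Proof.
rewrite lt0n; apply/eqP => r0; apply: (@jone_neq0 R J).
rewrite -(eigproj_sum 0) big1// => i; have := ltn_ord i.
by rewrite [X in (_ < X)%N]r0.
Qed.

Lemma jtr_jmulA x y w : jtr ((x ** y) ** w) = jtr (y ** (x ** w)).
Proof.
rewrite !jtrE !jformA (jmulC (x ** y)) trace_weight_central.
by rewrite [trace_weight ** y]jmulC.
Qed.

Lemma jtr_jmul_sum x y : jtr (x ** y) =
  \sum_i \sum_j eigval x i * eigval y j * jtr (eigproj x i ** eigproj y j).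
Proof.
rewrite [in LHS](spectralE x) [in LHS](spectralE y) jmul_suml jtr_sum.
apply: eq_bigr => i _; rewrite jmul_sumr jtr_sum; apply: eq_bigr => j _.
by rewrite jmulZl jmulZr !jtrZ mulrA.
Qed.

Lemma jtr_sqr x : jtr (x ** x) = \sum_i eigval x i ^+ 2.
Proof.
rewrite {1 2}(spectralE x) orthogonal_system_jmul; last exact: eigproj_system.
rewrite jtr_sum; apply: eq_bigr => i _.
by rewrite jtrZ jtr_primitive ?mulr1//; exact: eigproj_primitive.
Qed.

Lemma jtr_sqr_eq0 x : jtr (x ** x) = 0 -> x = 0.
Proof.
rewrite jtr_sqr => /eqP; rewrite psumr_eq0 => [/allP x0|i _];
  last exact: sqr_ge0.
rewrite (spectralE x) big1// => i _.
have := x0 i (mem_index_enum _); rewrite /= sqrf_eq0 => /eqP ->.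
by rewrite scale0r.
Qed.

Lemma jtr_primitiveM c d : primitive_idempotent c -> primitive_idempotent d ->
  jtr (c ** d) = jform c d / jform c c.
Proof.
by move=> cP dP; rewrite jtrE jformA (jmulC c) trace_weightP// jformZr mulrC
  jformC.
Qed.

Lemma jtr_primitiveM_ge0 c d : primitive_idempotent c ->
  primitive_idempotent d -> 0 <= jtr (c ** d).
Proof.
move=> cP dP; rewrite jtr_primitiveM// divr_ge0 ?jform_ge0//.
have -> : jform c d = jform (c ** d) d.
  by rewrite (jmulC c) jformA (primitive_idem dP).
exact: idempotent_form_ge0 (primitive_idem cP).
Qed.

End trace_form.

(** * Pinsker's inequality *)

Section kl_bound.
Context {R : realType}.
Implicit Types t a b : R.

(** The order of x and y is left open; the sign of the product records that t lies on the same side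
    of x as y. *)
Lemma MVT_pos (f df : R -> R) (x y : R) : 0 < x -> 0 < y ->
  (forall t, 0 < t -> is_derive t 1 f (df t)) ->
  exists t, [/\ 0 < t, 0 <= (t - x) * (y - x) & f y - f x = df t * (y - x)].
Proof.
move=> x0 y0 fdf.
have H u v : 0 < u -> u < v ->
    exists t, [/\ u < t, t < v & f v - f u = df t * (v - u)].
  move=> u0 uv; have [||t] := @MVT _ f df u v uv.
  - by move=> t; rewrite in_itv/= => /andP[ut _]; apply: fdf;
    rewrite (lt_trans u0).
  - apply: derivable_within_continuous => t; rewrite in_itv/= => /andP[ut _].
    by have ? := fdf t (lt_le_trans u0 ut); exact: ex_derive.
  - by rewrite in_itv/= => /andP[ut tv] E; exists t.
have [xy|yx|->] := ltgtP x y.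
- have [t [xt ty E]] := H _ _ x0 xy.
  by exists t; split; rewrite ?(lt_trans x0)// mulr_ge0// subr_ge0 ltW.
- have [t [yt tx E]] := H _ _ y0 yx; exists t; split; first exact: lt_trans yt.
    by rewrite nmulr_lge0 ?subr_lt0// subr_le0 ltW.
  by rewrite -opprB E -mulrN opprB.
- by exists y; rewrite !subrr !mulr0.
Qed.

(** The difference G of the two sides satisfies G 1 = G' 1 = 0 and G'' >= 0. Two applications of the
    mean value theorem give G t = G'' r * (s - 1) * (t - 1) with s on the same side of 1 as t. *)
Lemma kl_pinsker_kernel t : 0 < t ->
  3 * (t - 1) ^+ 2 <= (2 * t + 4) * (t * ln t - t + 1).
Proof.
move=> t0.
pose G (s : R) := (2 * s + 4) * (s * ln s - s + 1) - 3 * (s - 1) ^+ 2.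
pose G' (s : R) := (4 * s + 4) * ln s - 8 * s + 8.
pose G'' (s : R) := 4 * (ln s - 1 + s^-1).
have dG (s : R) : 0 < s -> is_derive s 1 G (G' s).
  move=> s0; have := is_derive1_ln s0 => ?.
  by apply: is_derive_eq; rewrite /GRing.scale/= /G'; field; rewrite gt_eqF.
have dG' (s : R) : 0 < s -> is_derive s 1 G' (G'' s).
  move=> s0; have := is_derive1_ln s0 => ?.
  by apply: is_derive_eq; rewrite /GRing.scale/= /G''; field; rewrite gt_eqF.
have G''_ge0 (s : R) : 0 < s -> 0 <= G'' s.
  move=> s0; rewrite /G'' mulr_ge0//.
  have := @le_ln1Dx R (s^-1 - 1);
    rewrite ltrBDr addrC subrr invr_gt0 addrC subrK => /(_ s0).
  by rewrite lnV ?posrE//; lra.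
have [s [s0 st GE]] := MVT_pos (ltr01 : 0 < 1 :> R) t0 dG.
have [r [r0 _ G'E]] := MVT_pos (ltr01 : 0 < 1 :> R) s0 dG'.
have G1 : G 1 = 0 by rewrite /G ln1; ring.
have G'1 : G' 1 = 0 by rewrite /G' ln1; ring.
have : 0 <= G t.
  move: GE G'E; rewrite G1 G'1 !subr0 => -> ->; rewrite -mulrA.
  by rewrite mulr_ge0 ?G''_ge0.
by rewrite /G subr_ge0.
Qed.

(* Up to scaling, the weights 2 and 4 are forced by the second-order behaviour
   at alpha = beta. *)
Lemma kl_pinsker_scalar (alpha beta : R) :
  3 * (expR alpha - expR beta) ^+ 2 <=
  (2 * expR alpha + 4 * expR beta) *
  (expR alpha * (alpha - beta) - expR alpha + expR beta).
Proof.
(* By homogeneity the claim is the one-variable inequality at exp (alpha - beta), multiplied by the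
   square of exp beta. *)
have := kl_pinsker_kernel (expR_gt0 (alpha - beta)).
rewrite expRK -(ler_pM2l (exprn_gt0 2 (expR_gt0 beta))) => H.
have E : expR alpha = expR beta * expR (alpha - beta) by rewrite -expRD addrC
  subrK.
by rewrite E; move: H; set x := expR (_ - _); set y := expR beta => H; lra.
Qed.

End kl_bound.

Lemma quadratic_ge0_discr (R : realFieldType) (A B C : R) : 0 <= C ->
  (forall l, 0 <= A + 2 * l * B + l ^+ 2 * C) -> B ^+ 2 <= A * C.
Proof.
move=> C0 H; have [CE|Cn0] := eqVneq C 0.
  have [->|B0] := eqVneq B 0; first by rewrite expr0n/= CE mulr0.
  (* At this point the affine function A + 2 l B would take the value -1. *)
  have := H (- (A + 1) / (2 * B)); rewrite CE mulr0 addr0.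
  have -> : 2 * (- (A + 1) / (2 * B)) * B = - (A + 1).
    by field.
  lra.
have Cp : 0 < C by rewrite lt0r Cn0.
have := H (- B / C).
rewrite -(pmulr_lge0 _ Cp).
have -> : (A + 2 * (- B / C) * B + (- B / C) ^+ 2 * C) * C = A * C - B ^+ 2.
  by field.
by rewrite subr_ge0.
Qed.

Lemma ler_AMGM2 (R : realDomainType) (X A B : R) : 0 <= A -> 0 <= B ->
  X ^+ 2 <= 4 * (A * B) -> X <= A + B.
Proof.
move=> A0 B0 H; have [X0|X0] := leP X 0;
  first by rewrite (le_trans X0)// addr_ge0.
rewrite -(@ler_pXn2r _ 2)// ?nnegrE ?addr_ge0//; last exact: ltW.
apply: (le_trans H); rewrite -subr_ge0.
have -> : (A + B) ^+ 2 - 4 * (A * B) = (A - B) ^+ 2 by ring.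
exact: sqr_ge0.
Qed.

(** * Positivity of the quadratic representation and duality of the trace norms *)

Section cone.
Context {R : realType} {J : ejaType R}.
Implicit Types (x y z u v w c d h s : J) (a b : R).

Lemma jtr_primitive_sqr_ge0 d y : primitive_idempotent d ->
  0 <= jtr (d ** (y ** y)).
Proof.
move=> dP; rewrite {1 2}(spectralE y) orthogonal_system_jmul;
  last exact: eigproj_system.
rewrite jmul_sumr jtr_sum sumr_ge0// => i _.
rewrite jmulZr jtrZ mulr_ge0 ?sqr_ge0// jtr_primitiveM_ge0//.
exact: eigproj_primitive.
Qed.

(* The image of a primitive idempotent under the quadratic representation has
   rank at most one, hence is a nonnegative multiple of its own square. *)
Lemma quad_primitive_ge0 c d x : primitive_idempotent c ->
  primitive_idempotent d ->
  0 <= jtr (d ** (2 *: (x ** (x ** c)) - (x ** x) ** c)).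
Proof.
move=> cP dP; have cc := primitive_idem cP.
have [xi E1] : exists xi, 2 *: (c ** (c ** x)) - c ** x = xi *: c.
  by exists (jform x c / jform c c); exact: primitive_quad.
(* The polynomial 4t (1 - t) is 1 at 1/2 and 0 at 0 and 1, so h is the Peirce 1/2-component of x;
   likewise xi c is the 1-component and x0 the 0-component. *)
pose h := 4 *: (c ** x - c ** (c ** x)).
pose x0 := x - xi *: c - h.
have xE : x = xi *: c + h + x0 by rewrite /x0 addrC addrACA;
  apply: jform_ext => u; rewrite !jlinE; lra.
have cub u : 2 * jform (c ** (c ** (c ** x))) u + jform (c ** x) u =
    3 * jform (c ** (c ** x)) u.
  by have /(congr1 (fun t => jform t u)) := peirce_cubic x cc; rewrite !jlinE.
have ch : c ** h = 2^-1 *: h.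
  apply: jform_ext => u; rewrite /h !jlinE.
  have := cub u; lra.
have cx0 : c ** x0 = 0.
  rewrite /x0 -E1 /h; apply: jform_ext => u; rewrite !jlinE.
  have := cub u; lra.
clearbody h x0.
have [g [g0 cg]] : exists g, 0 <= g /\ c ** (h ** h) = g *: c.
  exists (jform (h ** h) c / jform c c); split.
    by rewrite divr_ge0 ?jform_ge0// jformA (jmulC h) ch jformZr mulr_ge0
      ?jform_ge0 ?invr_ge0.
  by rewrite -(primitive_quad _ cP) (peircehh cc ch) scaler_nat mulr2n addrK.
(* The Jordan identity at h and c reads off h^3, because c acts on h as 1/2 and sends h^2 to g c. *)
have h3 : (h ** h) ** h = g *: h.
  have := jordan_identity h c; rewrite (jmulC h c) ch (jmulC (h ** h) c) cg.
  rewrite !jmulZr (jmulC h c) ch scalerA mulrC -scalerA.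
  by apply: scalerI; rewrite invr_neq0.
have h4 : (h ** h) ** (h ** h) = g *: (h ** h).
  by have := jordan_identity h h; rewrite h3 jmulZr.
have c00 : c ** (x0 ** x0) = 0 by exact: peirce00.
have c0h : c ** (x0 ** h) = 2^-1 *: (x0 ** h) by exact: peirce0h.
set w := _ - _ ** c.
have wE : w = xi ^+ 2 *: c + xi *: h + h ** h - g *: c.
  rewrite /w xE; apply: jform_ext => u.
  rewrite !jlinE ?(jmulC h c, jmulC x0 c, jmulC h x0, jmulC (h ** h) c, jmulC
    (x0 ** x0) c, jmulC (x0 ** h) c) ?(cc, ch, cx0, cg, c00, c0h).
  rewrite !jlinE ?(jmulC h c, jmulC x0 c, jmulC h x0) ?(cc, ch, cx0).
  rewrite !jlinE ?(jmulC h c, jmulC x0 c, jmulC h x0) ?(cc, ch, cx0).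
  lra.
have ww : w ** w = (xi ^+ 2 + g) *: w.
  rewrite wE; apply: jform_ext => u.
  rewrite !jlinE ?(jmulC h c, jmulC (h ** h) c, jmulC h (h ** h)).
  rewrite ?(cc, ch, cg, h3, h4) !jlinE; lra.
have [k0|k0] := eqVneq (xi ^+ 2 + g) 0.
  suff -> : w = 0 by rewrite jmulx0 jtr0.
  by apply: jtr_sqr_eq0; rewrite ww k0 scale0r jtr0.
have -> : w = (xi ^+ 2 + g)^-1 *: (w ** w) by rewrite ww scalerA mulVf//
  scale1r.
by rewrite jmulZr jtrZ mulr_ge0 ?invr_ge0 ?addr_ge0 ?sqr_ge0//
  jtr_primitive_sqr_ge0.
Qed.

Lemma quad_primitive_discr c d s : primitive_idempotent c ->
  primitive_idempotent d ->
  jtr (d ** (s ** c)) ^+ 2 <=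
  jtr (d ** c) * jtr (d ** (2 *: (s ** (s ** c)) - (s ** s) ** c)).
Proof.
move=> cP dP; apply: quadratic_ge0_discr; first exact: quad_primitive_ge0.
move=> l; have := quad_primitive_ge0 (jone + l *: s) cP dP.
set A := (X in 0 <= jtr (d ** X)).
suff -> : A = c + (2 * l) *: (s ** c) +
    l ^+ 2 *: (2 *: (s ** (s ** c)) - (s ** s) ** c).
  by rewrite jmulDr jmulDr !jmulZr jtrD jtrD !jtrZ.
apply: jform_ext => u; rewrite /A !jlinE ?(jmul1x, jmulx1); lra.
Qed.

(** The eigenvalue 0 gets sign 1, so that the result squares to the identity even when x is
    singular. *)
Definition jsign x : J :=
  \sum_i (if 0 <= eigval x i then 1 else -1) *: eigproj x i.

Lemma jsign_sqr x : jsign x ** jsign x = jone.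
Proof.
rewrite /jsign orthogonal_system_jmul; last exact: eigproj_system.
rewrite -(eigproj_sum x); apply: eq_bigr => i _.
by case: ifP => _; rewrite ?mulrNN mulr1 scale1r.
Qed.

Lemma norm_tr1_sign x : norm_tr1 x = jtr (jsign x ** x).
Proof.
rewrite [X in jtr (_ ** X)](spectralE x) /jsign orthogonal_system_jmul;
  last exact: eigproj_system.
rewrite jtr_sum; apply: eq_bigr => i _.
rewrite jtrZ jtr_primitive ?mulr1; last exact: eigproj_primitive.
case: ifP => [x0|/negbT]; first by rewrite mul1r ger0_norm.
by rewrite -ltNge => x0; rewrite mulN1r ltr0_norm.
Qed.

(** For an involution s, the square of e + s or e - s is twice itself; nonnegative traces against a
    primitive q give |tr (s o q)| <= 1. With [norm_tr1_sign] this makes the norm a maximum of linear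
    functionals, hence subadditive. *)
Lemma involution_norm_tr1 s x : s ** s = jone -> jtr (s ** x) <= norm_tr1 x.
Proof.
move=> ss; rewrite {1}(spectralE x) jmul_sumr jtr_sum; apply: ler_sum => i _.
rewrite jmulZr jtrZ; set q := eigproj x i.
have qP : primitive_idempotent q by exact: eigproj_primitive.
have sq : `|jtr (s ** q)| <= 1.
  have e1 : (jone - s) ** (jone - s) = 2 *: jone - 2 *: s.
    by apply: jform_ext => u; rewrite !jlinE ss ?(jmul1x, jmulx1); lra.
  have e2 : (jone + s) ** (jone + s) = 2 *: jone + 2 *: s.
    by apply: jform_ext => u; rewrite !jlinE ss ?(jmul1x, jmulx1); lra.
  have := jtr_primitive_sqr_ge0 (jone - s) qP;
    have := jtr_primitive_sqr_ge0 (jone + s) qP.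
  rewrite e1 e2 !jmulDr jmulNr !jmulZr !jtrD jtrN !jtrZ jmulx1 (jmulC q).
  by rewrite jtr_primitive// ler_norml => ? ?; apply/andP; split; lra.
by rewrite (le_trans (ler_norm _))// normrM ler_piMr.
Qed.

Lemma norm_tr1_ge0 x : 0 <= norm_tr1 x.
Proof. by apply: sumr_ge0. Qed.

Lemma norm_tr1D x y : norm_tr1 (x + y) <= norm_tr1 x + norm_tr1 y.
Proof.
by rewrite norm_tr1_sign jmulDr jtrD lerD// involution_norm_tr1// jsign_sqr.
Qed.

Lemma norm_tr1N x : norm_tr1 (- x) = norm_tr1 x.
Proof.
suff H y : norm_tr1 (- y) <= norm_tr1 y.
  by apply/eqP; rewrite eq_le H -{1}[x]opprK H.
rewrite norm_tr1_sign jmulNr -jmulNl involution_norm_tr1//.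
by rewrite jmulNl jmulNr opprK jsign_sqr.
Qed.

Lemma norm_troo_ge0 x : 0 <= norm_troo x.
Proof. by rewrite /norm_troo; elim/big_rec: _ => // i y _ y0;
  rewrite le_max y0 orbT. Qed.

(** For each j the numbers tr (q_i o p_j) are nonnegative weights of total 1 in i, where q and p are
    the frames of x and y. *)
Lemma norm_troo_dual x y : jtr (x ** y) <= norm_troo x * norm_tr1 y.
Proof.
rewrite jtr_jmul_sum exchange_big/= mulr_sumr; apply: ler_sum => j _.
rewrite [leRHS](_ : _ = \sum_i norm_troo x * `|eigval y j| *
    jtr (eigproj x i ** eigproj y j)); last first.
  rewrite -mulr_sumr -jtr_sum -jmul_suml eigproj_sum jmul1x.
  by rewrite jtr_primitive ?mulr1//; exact: eigproj_primitive.
apply: ler_sum => i _; apply: ler_wpM2r.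
  by apply: jtr_primitiveM_ge0; exact: eigproj_primitive.
rewrite (le_trans (ler_norm _))// normrM ler_wpM2r//.
by rewrite /norm_troo; apply: le_bigmax.
Qed.

End cone.

(** * The potential ln tr exp and its Bregman divergence *)

Section entropy.
Context {R : realType} {J : ejaType R}.
Implicit Types (x y z u v w c d h s : J) (a b : R).

Definition log_partition w : R := ln (jtr (jexp w)).

Definition softmax w : J := (jtr (jexp w))^-1 *: jexp w.

Lemma jtr_jexp w : jtr (jexp w) = \sum_i expR (eigval w i).
Proof.
rewrite jtr_sum; apply: eq_bigr => i _.
by rewrite jtrZ jtr_primitive ?mulr1//; exact: eigproj_primitive.
Qed.

Lemma expR_eigval_le w i : expR (eigval w i) <= jtr (jexp w).
Proof.
rewrite jtr_jexp (bigD1 i)//= lerDl sumr_ge0// => j _; exact: expR_ge0.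
Qed.

Lemma jtr_jexp_gt0 w : 0 < jtr (jexp w).
Proof.
exact: lt_le_trans (expR_gt0 _) (expR_eigval_le w (Ordinal (@rank_gt0 R J))).
Qed.

Lemma expR_log_partition w : expR (log_partition w) = jtr (jexp w).
Proof. by rewrite lnK// posrE jtr_jexp_gt0. Qed.

Lemma eigval_le_log_partition w i : eigval w i <= log_partition w.
Proof. by rewrite -ler_expR expR_log_partition expR_eigval_le. Qed.

Lemma softmaxE w :
  softmax w = \sum_i expR (eigval w i - log_partition w) *: eigproj w i.
Proof.
rewrite /softmax scaler_sumr; apply: eq_bigr => i _.
by rewrite scalerA expRB expR_log_partition mulrC.
Qed.

Lemma jtr_softmax w : jtr (softmax w) = 1.
Proof. by rewrite jtrZ mulVf// gt_eqF// jtr_jexp_gt0. Qed.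

Lemma simplex_softmax w : simplex J (softmax w).
Proof.
split; last exact: jtr_softmax.
exists (\sum_i expR ((eigval w i - log_partition w) / 2) *: eigproj w i) => //.
rewrite orthogonal_system_jmul ?softmaxE; last exact: eigproj_system.
by apply: eq_bigr => i _; rewrite -expRD -splitr.
Qed.

(** Here tr (w o z) is an average of the eigenvalues of w, with the weights tr (q_i o z). *)
Lemma jtr_le_log_partition w z : simplex J z -> jtr (w ** z) <= log_partition w.
Proof.
move=> [[y _ <-] y1]; rewrite [in leLHS](spectralE w) jmul_suml jtr_sum.
rewrite -[leRHS]mulr1 -y1 -[y ** y in leRHS]jmul1x -(eigproj_sum w) jmul_suml
  jtr_sum mulr_sumr.
apply: ler_sum => i _; rewrite jmulZl jtrZ; apply: ler_wpM2r.
  by apply: jtr_primitive_sqr_ge0; exact: eigproj_primitive.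
exact: eigval_le_log_partition.
Qed.

Lemma jexp0 : jexp (0 : J) = jone.
Proof.
have ev0 : eigval (0 : J) =1 fun=> 0.
  apply: (orthogonal_system_free (m := fun=> 0) (eigproj_system 0)).
  by rewrite -(spectralE 0) big1// => i _; rewrite scale0r.
rewrite -(eigproj_sum 0); apply: eq_bigr => i _.
by rewrite ev0 expR0 scale1r.
Qed.

Lemma softmax0 : softmax 0 = (rank J)%:R^-1 *: (jone : J).
Proof. by rewrite /softmax jexp0 jtr1. Qed.

Lemma log_partition0 : log_partition 0 = ln (rank J)%:R.
Proof. by rewrite /log_partition jexp0 jtr1. Qed.

Lemma sum_jtr v w (g : 'I_(rank J) -> R) (k : 'I_(rank J) -> R) :
  \sum_i \sum_j g i * k j * jtr (eigproj v i ** eigproj w j) =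
  jtr ((\sum_i g i *: eigproj v i) ** (\sum_j k j *: eigproj w j)).
Proof.
rewrite jmul_suml jtr_sum; apply: eq_bigr => i _.
rewrite jmul_sumr jtr_sum; apply: eq_bigr => j _.
by rewrite jmulZl jmulZr !jtrZ mulrA.
Qed.

(** This is the relative entropy of [softmax v] with respect to [softmax w], in both frames. The
    terms - exp al + exp be sum to zero, both traces being 1, and make every summand nonnegative. *)
Lemma bregman_log_partition v w :
  log_partition w - log_partition v - jtr ((w - v) ** softmax v) =
  \sum_i \sum_j
    (let al := eigval v i - log_partition v in
     let be := eigval w j - log_partition w in
     expR al * (al - be) - expR al + expR be) *
    jtr (eigproj v i ** eigproj w j).
Proof.
pose al i := eigval v i - log_partition v.
pose be j := eigval w j - log_partition w.
transitivity (
    \sum_i \sum_j ((expR (al i) * al i) * 1) * jtr (eigproj v i ** eigproj w j)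
  - \sum_i \sum_j (expR (al i) * be j) * jtr (eigproj v i ** eigproj w j)
  - \sum_i \sum_j (expR (al i) * 1) * jtr (eigproj v i ** eigproj w j)
  + \sum_i \sum_j (1 * expR (be j)) * jtr (eigproj v i ** eigproj w j)).
  have one x : \sum_i 1 *: eigproj x i = jone.
    by rewrite -(eigproj_sum x); apply: eq_bigr => i _; rewrite scale1r.
  have sub x : \sum_i (eigval x i - log_partition x) *: eigproj x i =
      x - log_partition x *: jone.
    transitivity (\sum_i eigval x i *: eigproj x i -
        log_partition x *: \sum_i eigproj x i).
      rewrite scaler_sumr -sumrB.
      by apply: eq_bigr => i _; rewrite scalerBl.
    by rewrite -spectralE eigproj_sum.
  rewrite !sum_jtr !one jmulx1 jmulx1 jmul1x -orthogonal_system_jmul;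
    last exact: eigproj_system.
  rewrite -!softmaxE !sub; have := jtr_softmax v; have := jtr_softmax w.
  move: (softmax v) (softmax w) => z u u1 z1.
  rewrite !jmulDr !jmulNr !jmulZr !jtrD !jtrN !jtrZ !jmulx1 z1 u1.
  by rewrite jmulDl jmulNl jtrD jtrN (jmulC w) (jmulC v); ring.
rewrite -!sumrB -big_split/=; apply: eq_bigr => i _.
rewrite -!sumrB -big_split/=; apply: eq_bigr => j _.
rewrite /= -/(al i) -/(be j).
by move: (expR (al i)) (expR (be j)) (al i) (be j) (jtr _) => ? ? ? ? ?; ring.
Qed.

(** The inequality between arithmetic and geometric means, with the factors 2z + 4u cancelling in
    the product of the two terms. *)
Lemma pinsker_term (z u B a Y t N : R) : 0 < z -> 0 < u -> 0 <= a -> 0 <= Y ->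
  3 * (z - u) ^+ 2 <= (2 * z + 4 * u) * B -> t ^+ 2 <= a * Y ->
  N * ((z - u) * t) <= B * a + N ^+ 2 / 4 * ((2 * z + 4 * u) / 3 * Y).
Proof.
move=> z0 u0 a0 Y0 KL tY.
have c0 : 0 < 2 * z + 4 * u by rewrite addr_gt0 ?mulr_gt0.
have B0 : 0 <= B.
  by rewrite -(pmulr_rge0 _ c0) (le_trans _ KL)// mulr_ge0// sqr_ge0.
apply: ler_AMGM2; first by rewrite mulr_ge0.
  apply: mulr_ge0; first by rewrite divr_ge0 ?sqr_ge0.
  by apply: mulr_ge0 => //; rewrite divr_ge0// ltW.
have -> : 4 * (B * a * (N ^+ 2 / 4 * ((2 * z + 4 * u) / 3 * Y))) =
    N ^+ 2 * (((2 * z + 4 * u) * B / 3) * (a * Y)) by field.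
rewrite !exprMn; apply: ler_wpM2l; first exact: sqr_ge0.
apply: ler_pM => //; rewrite ?sqr_ge0//.
by rewrite ler_pdivlMr// mulrC.
Qed.

Lemma bregman_log_partition_ge v w :
  norm_tr1 (softmax v - softmax w) ^+ 2 / 2 <=
  log_partition w - log_partition v - jtr ((w - v) ** softmax v).
Proof.
have := jsign_sqr (softmax v - softmax w).
have := norm_tr1_sign (softmax v - softmax w).
move: (jsign _) (norm_tr1 _) => s N N0 ss.
pose z i := expR (eigval v i - log_partition v).
pose u j := expR (eigval w j - log_partition w).
pose q i := eigproj v i; pose p j := eigproj w j.
pose t i j := jtr (q i ** (s ** p j)).
pose Y i j := jtr (q i ** (2 *: (s ** (s ** p j)) - (s ** s) ** p j)).
have qP i : primitive_idempotent (q i) by exact: eigproj_primitive.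
have pP i : primitive_idempotent (p i) by exact: eigproj_primitive.
have NE : N = \sum_i \sum_j (z i - u j) * t i j.
  rewrite N0.
  transitivity (\sum_i \sum_j z i * t i j - \sum_i \sum_j u j * t i j);
    last first.
    rewrite -sumrB; apply: eq_bigr => i _; rewrite -sumrB;
      apply: eq_bigr => j _.
    by rewrite mulrBl.
  rewrite jmulDr jmulNr jtrD jtrN; congr (_ - _).
    rewrite softmaxE jmul_sumr jtr_sum; apply: eq_bigr => i _.
    by rewrite jmulZr jtrZ -mulr_sumr -jtr_sum -jmul_sumr -jmul_sumr
      eigproj_sum jmulx1 jmulC.
  rewrite softmaxE jmul_sumr jtr_sum [RHS]exchange_big; apply: eq_bigr => j _.
  by rewrite jmulZr jtrZ -mulr_sumr -jtr_sum -jmul_suml eigproj_sum jmul1x.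
(* Since s o s = e, P(s) fixes e and preserves the trace, so the rows and columns of Y all have sum
   1. *)
have Yz i : \sum_j Y i j = 1.
  rewrite -jtr_sum -jmul_sumr sumrB -scaler_sumr -!jmul_sumr.
  rewrite eigproj_sum !jmulx1 ss scaler_nat mulr2n addrK jmulx1.
  exact: jtr_primitive.
have Yu j : \sum_i Y i j = 1.
  rewrite -jtr_sum -jmul_suml eigproj_sum jmul1x jtrB jtrZ.
  by rewrite ss jmul1x -jtr_jmulA ss jmul1x jtr_primitive//; ring.
have sum1 x : \sum_i expR (eigval x i - log_partition x) = 1.
  rewrite -(jtr_softmax x) softmaxE jtr_sum; apply: eq_bigr => i _.
  by rewrite jtrZ jtr_primitive ?mulr1//; exact: eigproj_primitive.
have YE (g k : 'I_(rank J) -> R) : \sum_i g i = 1 -> \sum_j k j = 1 ->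
    \sum_i \sum_j (2 * g i + 4 * k j) / 3 * Y i j = 2.
  move=> g1 k1.
  transitivity (2 / 3 * (\sum_i \sum_j g i * Y i j) +
                4 / 3 * (\sum_j \sum_i k j * Y i j)).
    rewrite [X in 4 / 3 * X]exchange_big !mulr_sumr -big_split.
    apply: eq_bigr => i _; rewrite !mulr_sumr -big_split.
    by apply: eq_bigr => j _ /=; ring.
  rewrite (eq_bigr g) => [|i _]; last by rewrite -mulr_sumr Yz mulr1.
  rewrite [X in 4 / 3 * X](eq_bigr k) => [|j _];
    last by rewrite -mulr_sumr Yu mulr1.
  by rewrite g1 k1; field.
rewrite bregman_log_partition.
set D := \sum_i _.
(* One factor N is expanded by [NE], and [pinsker_term] is summed over i and j; the weights (2 z_i +
   4 u_j) / 3 against Y total 2/3 + 4/3 = 2. *)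
suff : N * N <= D + N ^+ 2 / 4 * 2 by rewrite -expr2; lra.
rewrite {2}NE -[X in _ / 4 * X](YE z u (sum1 v) (sum1 w)) !mulr_sumr
  -big_split; apply: ler_sum => i _.
rewrite !mulr_sumr -big_split; apply: ler_sum => j _ /=.
apply: pinsker_term.
- exact: expR_gt0.
- exact: expR_gt0.
- exact: jtr_primitiveM_ge0.
- exact: quad_primitive_ge0.
- exact: kl_pinsker_scalar.
- exact: quad_primitive_discr s (pP j) (qP i).
Qed.

End entropy.

(** * Regret of optimistic multiplicative weights *)

Section product_trace.
Context {R : realType} {J1 J2 : ejaType R}.
Implicit Types z : (J1 * J2)%type.

(** A primitive idempotent (a, b) has a zero component, else (a, 0) + (0, b) would split it; the
    other component is primitive. *)
Lemma jtr_pair_primitive (c : (J1 * J2)%type) : primitive_idempotent c ->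
  jtr c.1 + jtr c.2 = 1.
Proof.
case: c => a b [ab0 [aa bb] abprim] /=.
have [b0|b0] := eqVneq b 0.
  move: ab0 abprim; rewrite b0 jtr0 addr0 => a0 aprim; apply: jtr_primitive;
    split => //.
    by move=> a0'; apply: a0; rewrite a0'.
  move=> [u [v [u0 v0 uu vv auv]]]; apply: aprim; exists (u, 0), (v, 0); split.
  - by case.
  - by case.
  - by congr pair; rewrite //= jmul0x.
  - by congr pair; rewrite //= jmul0x.
  - by rewrite auv; congr pair; rewrite /= addr0.
have [a0|a0] := eqVneq a 0.
  move: ab0 abprim; rewrite a0 jtr0 add0r => {}b0 bprim; apply: jtr_primitive;
    split => //.
    by move=> b0'; apply: b0; rewrite b0'.
  move=> [u [v [u0 v0 uu vv buv]]]; apply: bprim; exists (0, u), (0, v); split.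
  - by case.
  - by case.
  - by congr pair; rewrite //= jmul0x.
  - by congr pair; rewrite //= jmul0x.
  - by rewrite buv; congr pair; rewrite /= addr0.
exfalso; apply: abprim; exists (a, 0), (0, b); split.
- by case=> /eqP; rewrite (negbTE a0).
- by case=> /eqP; rewrite (negbTE b0).
- by congr pair; rewrite //= jmul0x.
- by congr pair; rewrite //= jmul0x.
- by congr pair; rewrite /= ?addr0 ?add0r.
Qed.

Lemma jtr_pair z : jtr z = jtr z.1 + jtr z.2.
Proof.
rewrite [in RHS](spectralE z).
have fstE I (r : seq I) (F : I -> (J1 * J2)%type) :
    (\sum_(i <- r) F i).1 = \sum_(i <- r) (F i).1.
  by elim/big_rec2: _ => // i u v _ <-.
have sndE I (r : seq I) (F : I -> (J1 * J2)%type) :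
    (\sum_(i <- r) F i).2 = \sum_(i <- r) (F i).2.
  by elim/big_rec2: _ => // i u v _ <-.
rewrite fstE sndE !jtr_sum -big_split; apply: eq_bigr => i _ /=.
by rewrite !jtrZ -mulrDr jtr_pair_primitive ?mulr1//; exact: eigproj_primitive.
Qed.

Lemma norm_tr1_pair z : norm_tr1 z <= norm_tr1 z.1 + norm_tr1 z.2.
Proof.
rewrite norm_tr1_sign jtr_pair; have := jsign_sqr z.
by case: (jsign z) => s1 s2 [ss1 ss2] /=; rewrite lerD// involution_norm_tr1.
Qed.

End product_trace.

Section regret.
Context {R : realType} {J : ejaType R}.
Implicit Types (a b d w : J).

(** One round: a is the scaled past payoff, m the prediction and m' the payoff received. Pinsker for
    the pairs (w, a) and (a', w) leaves the prediction error tested on softmax a' - softmax w, at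
    most eta D P; Pinsker for (a', w) and (w, a') added up gives P <= eta D. *)
Lemma mirror_step (eta : R) (a m m' :
  J) (w := a + eta *: m) (a' := a + eta *: m') :
  0 <= eta ->
  log_partition a' <= log_partition a + eta * jtr (m' ** softmax w)
    + eta ^+ 2 * norm_troo (m' - m) ^+ 2
    - norm_tr1 (softmax a' - softmax w) ^+ 2 / 2
    - norm_tr1 (softmax w - softmax a) ^+ 2 / 2.
Proof.
move=> eta0; pose d := m' - m.
have E1 : a - w = - (eta *: m) by rewrite /w opprD addrA subrr add0r.
have E2 : a' - w = eta *: d.
  by rewrite /a' /w opprD addrACA subrr add0r -scalerBr.
have E3 : w - a' = - (eta *: d) by rewrite -E2 opprB.
clearbody a' w.
have := bregman_log_partition_ge w a; rewrite E1 jmulNl jmulZl jtrN jtrZ.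
have := bregman_log_partition_ge a' w; rewrite E3 jmulNl jmulZl jtrN jtrZ.
have := bregman_log_partition_ge w a'; rewrite E2 jmulZl jtrZ.
rewrite -[softmax w - softmax a']opprB norm_tr1N.
set P := norm_tr1 (softmax a' - softmax w);
  set Q := norm_tr1 (softmax w - softmax a).
have := norm_troo_dual d (softmax a' - softmax w);
  rewrite -/P jmulDr jmulNr jtrD jtrN.
have -> : jtr (m' ** softmax w) = jtr (d ** softmax w) + jtr (m ** softmax w).
  by rewrite -jtrD -jmulDl subrK.
rewrite -/d.
have P0 : 0 <= P by exact: norm_tr1_ge0.
have D0 : 0 <= norm_troo d by exact: norm_troo_ge0.
move: P Q (norm_troo d) P0 D0 (jtr (d ** softmax w)) (jtr (d ** softmax a'))
  (jtr (m ** softmax w)).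
move: (log_partition a) (log_partition a') (log_partition w).
move=> fa fa' fw P Q D P0 D0 x x' y H1 H2 H3 H4.
have H5 : eta * (x' - x) <= eta * (D * P) by apply: ler_wpM2l.
have PD : P <= eta * D.
  have [->|Pn0] := eqVneq P 0; first by rewrite mulr_ge0.
  have Pp : 0 < P by rewrite lt0r Pn0.
  by rewrite -(ler_pM2r Pp); lra.
have H6 : (eta * D) * P <= (eta * D) * (eta * D) by apply: ler_wpM2l => //;
  rewrite mulr_ge0.
lra.
Qed.

Lemma oscmwu_regret (eta : R) (m z : nat -> J) (T : nat) (zs : J) :
  0 <= eta -> oscmwu eta m z -> simplex J zs ->
  eta * \sum_(t < T) jtr (m t.+1 ** (zs - z t.+1)) <=
  ln (rank J)%:R + \sum_(t < T) (eta ^+ 2 * norm_troo (m t.+1 - m t) ^+ 2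
    - norm_tr1 (z t.+1 - z t) ^+ 2 / 4).
Proof.
(* Payoffs accumulate from round 1; [m 0] enters only as the first prediction. *)
move=> eta0 [z0 zS] zsD; pose S t := \sum_(1 <= k < t.+1) m k.
have S0 : S 0%N = 0 by rewrite /S big_geq.
have SS t : S t.+1 = S t + m t.+1 by rewrite /S big_nat_recr.
have zE t : z t.+1 = softmax (eta *: (S t + m t)) by rewrite zS.
pose u t := softmax (eta *: S t).
have zu0 : z 0%N = u 0%N by rewrite /u S0 scaler0 softmax0.
(* Here u is the sequence without prediction. Keeping the distance from [u T] to [z T] on the left
   lets it join, in the next round, the one from [z T.+1] to [u T]; together they dominate a quarter
   of the squared move of z. *)
have main : log_partition (eta *: S T) + norm_tr1 (u T - z T) ^+ 2 / 2 <=
    ln (rank J)%:R + eta * \sum_(t < T) jtr (m t.+1 ** z t.+1) +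
    \sum_(t < T) (eta ^+ 2 * norm_troo (m t.+1 - m t) ^+ 2
      - norm_tr1 (z t.+1 - z t) ^+ 2 / 4).
  elim: T => [|T IHT].
    rewrite !big_ord0 S0 scaler0 log_partition0 zu0 subrr mulr0 !addr0.
    suff -> : norm_tr1 (0 : J) = 0 by rewrite expr0n/= mul0r addr0.
    by rewrite norm_tr1_sign jmulx0 jtr0.
  rewrite !big_ord_recr/=.
  have := mirror_step (eta *: S T) (m T) (m T.+1) eta0.
  rewrite -!scalerDr -SS -zE -/(u T) -/(u T.+1).
  have : norm_tr1 (z T.+1 - z T) ^+ 2 <=
      2 * norm_tr1 (z T.+1 - u T) ^+ 2 + 2 * norm_tr1 (u T - z T) ^+ 2.
    have : norm_tr1 (z T.+1 - z T) <= norm_tr1 (z T.+1 - u T) + norm_tr1 (u T -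
      z T).
      by rewrite (le_trans _ (norm_tr1D _ _))// addrA subrK.
    rewrite -(ler_pXn2r (ltn0Sn 1)) ?nnegrE ?addr_ge0 ?norm_tr1_ge0//.
    move=> /le_trans; apply; rewrite -subr_ge0.
    set A := norm_tr1 _; set B := norm_tr1 _.
    have -> : 2 * A ^+ 2 + 2 * B ^+ 2 - (A + B) ^+ 2 = (A - B) ^+ 2 by ring.
    exact: sqr_ge0.
  move: IHT; rewrite mulrDr; lra.
have Gb : eta * \sum_(t < T) jtr (m t.+1 ** zs) <= log_partition (eta *: S T).
  have := jtr_le_log_partition (eta *: S T) zsD.
  rewrite jmulZl jtrZ /S jmul_suml jtr_sum big_add1/= big_mkord.
  exact: le_trans.
have : 0 <= norm_tr1 (u T - z T) ^+ 2 by exact: sqr_ge0.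
have -> : \sum_(t < T) jtr (m t.+1 ** (zs - z t.+1)) =
    \sum_(t < T) jtr (m t.+1 ** zs) - \sum_(t < T) jtr (m t.+1 ** z t.+1).
  by rewrite -sumrB; apply: eq_bigr => t _; rewrite jmulDr jmulNr jtrB.
move: main Gb; rewrite mulrBr; lra.
Qed.

End regret.

(** * Gradients and compactness of the simplex *)

Section linear_functionals.
Context {R : realType} {J : ejaType R}.
Implicit Types (x y z u v : J).

Lemma r2vE (u : 'rV[R]_(dim J)) :
  r2v u = \sum_j u 0 j *: (r2v (delta_mx 0 j) : J).
Proof. by rewrite {1}(row_sum_delta u) linear_sum; apply: eq_bigr => j _;
  rewrite linearZ. Qed.

(** The Gram matrix of the trace form is invertible because the form is definite ([jtr_sqr_eq0]). *)
Lemma jtr_riesz (phi : J -> R) :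
  (forall a x y, phi (a *: x + y) = a * phi x + phi y) ->
  exists v, forall h, phi h = jtr (v ** h).
Proof.
move=> phil; pose e (j : 'I_(dim J)) : J := r2v (delta_mx 0 j).
have phi0 : phi 0 = 0.
  by have := phil (-1) 0 0; rewrite scaler0 addr0 mulN1r addNr.
have phiZ a x : phi (a *: x) = a * phi x.
  by rewrite -[a *: x]addr0 phil phi0 addr0.
have phiD x y : phi (x + y) = phi x + phi y.
  by rewrite -[x]scale1r phil mul1r scale1r.
have phi_sum I (r : seq I) (F : I -> J) :
  phi (\sum_(i <- r) F i) = \sum_(i <- r) phi (F i).
  by elim/big_rec2: _ => // i a b _ <-.
pose G := \matrix_(i, j) jtr (e i ** e j).
have uG (u : 'rV_(dim J)) j : (u *m G) 0 j = jtr (r2v u ** e j).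
  rewrite mxE r2vE jmul_suml jtr_sum; apply: eq_bigr => i _.
  by rewrite mxE jmulZl jtrZ.
have Gu : G \in unitmx.
  rewrite -row_free_unit -kermx_eq0; apply/eqP/row_matrixP => k.
  rewrite row0; have := congr1 (row k) (mulmx_ker G); rewrite row0 row_mul.
  set u := row k _ => uG0; apply: (can_inj r2vK); rewrite linear0.
  apply: jtr_sqr_eq0; rewrite [X in _ ** X]r2vE jmul_sumr jtr_sum big1// => j _.
  by rewrite jmulZr jtrZ -/(e j) -uG uG0 [X in _ * X]mxE mulr0.
exists (r2v ((\row_j phi (e j)) *m invmx G)) => h.
rewrite -[h]v2rK [r2v (v2r h)]r2vE phi_sum jmul_sumr jtr_sum;
  apply: eq_bigr => j _.
by rewrite phiZ jmulZr jtrZ -/(e j) -uG mulmxKV// mxE.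
Qed.

Lemma r2v_continuous : continuous (r2v : 'rV[R]_(dim J) -> J).
Proof.
move=> u; rewrite (_ : (r2v : 'rV[R]_(dim J) -> J) =
    fun w => \sum_j w 0 j *: r2v (delta_mx 0 j)); last by apply/funext => w;
      exact: r2vE.
apply: cvg_big; [exact: add_continuous|exact: nbhs_filter|move=> j _].
apply: cvgZr_tmp; first exact: nbhs_filter.
exact: (@coord_continuous R 1 (dim J) 0 j u).
Qed.

Lemma jtr_r2v_continuous x : continuous (fun u : 'rV[R]_(dim J) =>
  jtr (x ** r2v u)).
Proof.
move=> u; rewrite (_ : (fun w : 'rV[R]_(dim J) => jtr (x ** r2v w)) =
    fun w => \sum_j w 0 j * jtr (x ** r2v (delta_mx 0 j))); last first.
  apply/funext => w; rewrite r2vE jmul_sumr jtr_sum; apply: eq_bigr => j _.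
  by rewrite jmulZr jtrZ.
apply: cvg_big; [exact: add_continuous|exact: nbhs_filter|move=> j _].
apply: cvgMr_tmp; first exact: nbhs_filter.
exact: (@coord_continuous R 1 (dim J) 0 j u).
Qed.

(** An eigenvalue is the trace against its own projection. This dual description shows the cone to
    be closed and convex. *)
Lemma cone_of_squaresP x : cone_of_squares x <->
  forall d, primitive_idempotent d -> 0 <= jtr (d ** x).
Proof.
split=> [[y _ <-] d dP|xd]; first exact: jtr_primitive_sqr_ge0.
exists (\sum_i Num.sqrt (eigval x i) *: eigproj x i) => //.
rewrite orthogonal_system_jmul; last exact: eigproj_system.
rewrite [RHS]spectralE; apply: eq_bigr => i _; rewrite -expr2 sqr_sqrtr//.
have /xd := eigproj_primitive x i.
rewrite [X in _ ** X]spectralE orthogonal_system_mul;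
  last exact: eigproj_system.
by rewrite jtrZ jtr_primitive ?mulr1//; exact: eigproj_primitive.
Qed.

Lemma simplex_norm_tr1 x : simplex J x -> norm_tr1 x = 1.
Proof.
move=> [/cone_of_squaresP xd <-]; apply: eq_bigr => i _; rewrite ger0_norm//.
have /xd := eigproj_primitive x i.
rewrite [X in _ ** X]spectralE orthogonal_system_mul;
  last exact: eigproj_system.
by rewrite jtrZ jtr_primitive ?mulr1//; exact: eigproj_primitive.
Qed.

Lemma simplex_neq0 : simplex J !=set0.
Proof. by exists (softmax 0); exact: simplex_softmax. Qed.

Lemma simplex_avg (T : nat) (x : nat -> J) : (forall t, simplex J (x t)) ->
  (0 < T)%N -> simplex J (T%:R^-1 *: \sum_(t < T) x t.+1).
Proof.
move=> xD T0; split.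
  apply/cone_of_squaresP => d dP; rewrite jmulZr jtrZ jmul_sumr jtr_sum.
  rewrite mulr_ge0 ?invr_ge0 ?sumr_ge0// => t _.
  by have [/cone_of_squaresP/(_ _ dP)] := xD t.+1.
rewrite jtrZ jtr_sum (eq_bigr (fun=> 1)) => [|t _]; last by have [] := xD t.+1.
by rewrite big_const_ord iter_addr addr0 mulVf// pnatr_eq0 -lt0n.
Qed.

(** In coordinates the simplex is bounded, as each coordinate is a trace functional and [norm_tr1]
    is 1 there, and closed, being cut out by trace inequalities and one equation. *)
Lemma simplex_compact : compact (simplex J).
Proof.
have -> : simplex J = r2v @` [set u : 'rV[R]_(dim J) | simplex J (r2v u)].
  apply/seteqP; split=> [x xD|_ [u uD <-]//].
  by exists (v2r x); rewrite /= v2rK.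
apply: continuous_compact.
  by apply: continuous_subspaceT; exact: r2v_continuous.
apply: bounded_closed_compact.
  have /choice[c cE] (j : 'I_(dim J)) : exists c :
    J, forall h, v2r h 0 j = jtr (c ** h).
    by apply: jtr_riesz => a x y; rewrite linearP !mxE.
  pose M := \sum_j norm_troo (c j).
  exists M; split; first by rewrite num_real.
  move=> b Mb u uD; rewrite /= [X in X <= _]mx_normrE; apply: bigmax_le.
    by rewrite (le_trans _ (ltW Mb))// sumr_ge0// => j _; exact: norm_troo_ge0.
  move=> [i j] _ /=; rewrite (ord1 i).
  rewrite (le_trans _ (ltW Mb))//; apply: (@le_trans _ _ (norm_troo (c j))).
    have H (x : J) : v2r x 0 j <= norm_troo (c j) * norm_tr1 x.
      by rewrite cE norm_troo_dual.
    have uN := simplex_norm_tr1 uD.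
    have := H (r2v u); have := H (- r2v u).
    rewrite norm_tr1N uN mulr1 linearN mxE => Hn; rewrite r2vK => Hp;
      rewrite /= r2vK in Hn.
    by rewrite ler_norml Hp andbT lerNl.
  rewrite /M (bigD1 j)//= lerDl sumr_ge0// => k _; exact: norm_troo_ge0.
rewrite (_ : [set u | _] =
    (fun u : 'rV[R]_(dim J) => jtr (jone ** r2v u)) @^-1` [set 1 : R] `&`
    \bigcap_(d in [set d : J | primitive_idempotent d])
    (fun u : 'rV[R]_(dim J) => jtr (d ** r2v u)) @^-1` [set a | 0 <= a]).
  apply: closedI.
    apply: preimage_closed; last exact: closed_eq.
    by move=> u _; exact: jtr_r2v_continuous.
  apply: closed_bigI => d _; apply: preimage_closed; last exact: closed_ge.
  by move=> u _; exact: jtr_r2v_continuous.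
apply/seteqP; split=> u /=.
  move=> [/cone_of_squaresP uK u1]; split; first by rewrite /= jmul1x.
  by move=> d /= dP; exact: uK.
move=> [+ uK]; rewrite /= jmul1x => u1; split=> //.
by apply/cone_of_squaresP => d dP; exact: (uK d).
Qed.

End linear_functionals.

(** * First-order inequalities for convex functions *)

Section convex_gradient.
Context {R : realType} {J : ejaType R}.
Implicit Types (x y z u v h : J) (g : J -> R).

Lemma gradP g x : differentiable g x ->
  forall h, 'd g x h = jtr (grad g x ** h).
Proof.
move=> gx; rewrite /grad.
apply: (xgetPex (0 : J) (P := [set v | forall h, 'd g x h = tr_inner v h])).
have [a u w|v vE] := @jtr_riesz R J ('d g x); first by rewrite linearP.
by exists v => h; rewrite vE.
Qed.

Lemma convex_functionP g x y (t : R) : convex_function setT g ->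
  0 <= t -> t <= 1 -> g (t *: x + (1 - t) *: y) <= t * g x + (1 - t) * g y.
Proof.
move=> gconv t0 t1.
by have := gconv (Itv01 t0 t1) x y; rewrite !inE => /(_ Logic.I Logic.I).
Qed.

Lemma convex_first_order g x y : convex_function setT g -> differentiable g x ->
  g x + jtr (grad g x ** (y - x)) <= g y.
Proof.
move=> gconv gx; rewrite -gradP// -deriveE// addrC -lerBrDr leNgt.
apply/negP => lt_derive.
have /cvgr_gt/(_ _ lt_derive) : derivable g x (y - x) by exact: diff_derivable.
(* This t is within the radius where the difference quotient exceeds g y - g x, and in (0, 1], where
   convexity forbids that. *)
move=> [e /= e0 He]; pose t := Num.min (e / 2) 1.
have t0 : 0 < t by rewrite lt_min divr_gt0//=.
have t1 : t <= 1 by rewrite ge_min lexx orbT.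
have te : t < e.
  by rewrite gt_min ltr_pdivrMr// ltr_pMr// ltr1n.
have := He t; rewrite /= sub0r normrN gtr0_norm// => /(_ te).
rewrite gt_eqF// => /(_ isT).
have -> : t *: (y - x) + x = t *: y + (1 - t) *: x.
  by rewrite scalerBr scalerBl scale1r addrA addrAC.
apply/negP; rewrite -leNgt -(ler_pM2l t0) mulrA mulfV ?gt_eqF// mul1r.
have := convex_functionP y x gconv (ltW t0) t1; lra.
Qed.

Lemma concave_first_order g x y : convex_function setT (fun z => - g z) ->
  differentiable g x -> g y <= g x + jtr (grad g x ** (y - x)).
Proof.
move=> gconv gx.
have Ngx : differentiable (fun z => - g z) x by exact: (differentiableN gx).
have dN : 'D_(y - x) (fun z => - g z) x = - 'D_(y - x) g x.
  exact: (deriveN (diff_derivable gx)).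
have E : jtr (grad (fun z => - g z) x ** (y - x)) = - jtr (grad g x ** (y - x)).
  apply: etrans (esym (gradP Ngx (y - x))) _.
  apply: etrans (esym (deriveE (y - x) Ngx)) _; apply: etrans dN _.
  by rewrite (deriveE _ gx) (gradP gx).
have H : - g x + jtr (grad (fun z => - g z) x ** (y - x)) <= - g y.
  exact: (@convex_first_order (fun z => - g z) x y gconv Ngx).
by move: H; rewrite [X in _ + X <= _]E -opprD lerN2.
Qed.

End convex_gradient.

(** Jensen's inequality by summing the tangent inequalities at the mean, whose linear terms
    cancel. *)
Lemma convex_average (R : realType) (J : ejaType R) (g : J -> R) (x : nat -> J)
    (T : nat) : convex_function setT g -> (forall z, differentiable g z) ->
  (0 < T)%N ->
  g (T%:R^-1 *: \sum_(t < T) x t.+1) <= T%:R^-1 * \sum_(t < T) g (x t.+1).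
Proof.
move=> gconv gdiff T0; set xb := _ *: _.
have Tn0 : T%:R != 0 :> R by rewrite pnatr_eq0 -lt0n.
rewrite -(ler_pM2l (_ : 0 < T%:R)) ?ltr0n// mulrA mulfV// mul1r.
have : \sum_(t < T) (g xb + jtr (grad g xb ** (x t.+1 - xb))) <=
    \sum_(t < T) g (x t.+1).
  by apply: ler_sum => t _; exact: convex_first_order.
rewrite big_split/= sumr_const card_ord -jtr_sum -jmul_sumr sumrB sumr_const
  card_ord.
rewrite -[xb *+ T]scaler_nat {2}/xb scalerA mulfV// scale1r subrr jmulx0 jtr0
  addr0.
by rewrite mulr_natl.
Qed.

Lemma is_max_sup (R : realType) (A : set R) m : is_max A m -> sup A = m.
Proof.
move=> [Am mub]; apply/eqP; rewrite eq_le ge_sup//=; last by exists m.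
by apply: ub_le_sup => //; exists m.
Qed.

Lemma is_min_inf (R : realType) (A : set R) m : is_min A m -> inf A = m.
Proof.
move=> [Am mlb]; apply/eqP; rewrite eq_le lb_le_inf//= ?andbT; last by exists m.
by apply: ge_inf => //; exists m.
Qed.

(** * Saddle points *)

Section zero_sum_game.
Context {R : realType} {J1 J2 : ejaType R}.
Variable f : J1 * J2 -> R.
Hypothesis f_diff : forall z, differentiable f z.
Implicit Types (x : J1) (y : J2).

Lemma differentiable_section1 x y : differentiable (fun a : J1 => f (a, y)) x.
Proof.
by apply: (@differentiable_comp _ _ _ _ (fun a : J1 => (a, y)) f) => //.
Qed.

Lemma differentiable_section2 x y : differentiable (fun b : J2 => f (x, b)) y.
Proof.
by apply: (@differentiable_comp _ _ _ _ (fun b : J2 => (x, b)) f) => //.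
Qed.

Lemma payoff1_regret x y x' :
  convex_function setT (fun a : J1 => f (a, y)) ->
  f (x, y) - f (x', y) <= jtr (payoff1 f (x, y) ** (x' - x)).
Proof.
move=> fconv.
have := convex_first_order x' fconv (differentiable_section1 x y).
by rewrite /payoff1 /= jmulNl jtrN; lra.
Qed.

Lemma payoff2_regret x y y' :
  convex_function setT (fun b : J2 => - f (x, b)) ->
  f (x, y') - f (x, y) <= jtr (payoff2 f (x, y) ** (y' - y)).
Proof.
move=> fconv.
have := concave_first_order y' fconv (differentiable_section2 x y).
by rewrite /payoff2 /=; lra.
Qed.

Lemma max_yP x : is_max (values_y f x) (max_y f x).
Proof.
have [|y /set_mem yD ymax] := @compact_EVT_max _ R (fun b => f (x, b))
    (simplex J2) (@simplex_neq0 _ _) (@simplex_compact _ _).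
  apply: continuous_subspaceT => y.
  by apply: differentiable_continuous; exact: differentiable_section2.
have H : is_max (values_y f x) (f (x, y)).
  split; first by exists y.
  by move=> _ [y' /mem_set y'D <-]; exact: ymax.
by rewrite /max_y (is_max_sup H).
Qed.

Lemma min_xP y : is_min (values_x f y) (min_x f y).
Proof.
have [|x /set_mem xD xmin] := @compact_EVT_min _ R (fun a => f (a, y))
    (simplex J1) (@simplex_neq0 _ _) (@simplex_compact _ _).
  apply: continuous_subspaceT => x.
  by apply: differentiable_continuous; exact: differentiable_section1.
have H : is_min (values_x f y) (f (x, y)).
  split; first by exists x.
  by move=> _ [x' /mem_set x'D <-]; exact: xmin.
by rewrite /min_x (is_min_inf H).
Qed.

(** All the optimal values in [has_value] are squeezed to f (x, y). *)
Lemma has_value_of_saddle_point x y : simplex J1 x -> simplex J2 y ->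
  saddle_point f 0 x y -> has_value f.
Proof.
move=> xD yD xy.
have maxE : max_y f x = f (x, y).
  apply: is_max_sup; split; first by exists y.
  by move=> _ [y' y'D <-]; have /andP[] := xy x y' xD y'D; rewrite subr0.
have minE : min_x f y = f (x, y).
  apply: is_min_inf; split; first by exists x.
  by move=> _ [x' x'D <-]; have /andP[_] := xy x' y x'D yD; rewrite addr0.
have Hmin : is_min [set max_y f a | a in simplex J1] (f (x, y)).
  split; first by exists x.
  move=> _ [x' x'D <-]; have /andP[_] := xy x' y x'D yD;
    rewrite addr0 => /le_trans; apply.
  by have [_] := max_yP x'; apply; exists y.
have Hmax : is_max [set min_x f b | b in simplex J2] (f (x, y)).
  split; first by exists y.
  move=> _ [y' y'D <-]; have /andP[+ _] := xy x y' xD y'D; rewrite subr0;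
    apply: le_trans.
  by have [_] := min_xP y'; apply; exists x.
have E1 : minmax f = f (x, y) by exact: is_min_inf.
have E2 : maxmin f = f (x, y) by exact: is_max_sup.
by split; rewrite ?E1 ?E2// => *; [exact: max_yP|exact: min_xP].
Qed.

(* The value is attained at a cluster point of the approximate saddle points. *)
Lemma has_value_of_approximation (x : nat -> J1) (y : nat -> J2) (C : R) :
  (forall n, simplex J1 (x n)) -> (forall n, simplex J2 (y n)) ->
  (forall n x' y', simplex J1 x' -> simplex J2 y' ->
    f (x n, y') - f (x', y n) <= C / n.+1%:R) -> has_value f.
Proof.
move=> xD yD xyC.
have := @compact_setX _ _ _ _ (@simplex_compact R J1) (@simplex_compact R J2).
move=> /(_ ((fun n => (x n, y n)) @ \oo) _)[|[p1 p2] [[/= p1D p2D] pcl]].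
  by exists 0%N => // n _; split; [exact: xD|exact: yD].
suff H x' y' : simplex J1 x' -> simplex J2 y' -> f (p1, y') <= f (x', p2).
  apply: (@has_value_of_saddle_point p1 p2) => // x' y' x'D y'D.
  by rewrite subr0 addr0 !H.
move=> x'D y'D; rewrite leNgt; apply/negP => lt_f.
pose g (w : J1 * J2) := f (w.1, y') - f (x', w.2).
have gcont : {for (p1, p2), continuous g}.
  apply: cvgB.
    apply: (@cvg_comp _ _ _ (fun w : J1 * J2 => w.1) (fun a => f (a, y')));
      first exact: cvg_fst.
    by apply: differentiable_continuous; exact: differentiable_section1.
  apply: (@cvg_comp _ _ _ (fun w : J1 * J2 => w.2) (fun b => f (x', b)));
    first exact: cvg_snd.
  by apply: differentiable_continuous; exact: differentiable_section2.
(* Half the supposed violation: g exceeds it near the cluster point, while along the sequence g is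
   eventually at most C / (n + 1) <= [dlt]. *)
pose dlt := (f (p1, y') - f (x', p2)) / 2.
have d0 : 0 < dlt by rewrite divr_gt0// subr_gt0.
have near_p : nbhs (p1, p2) [set w | dlt < g w].
  apply: (cvgr_gt _ gcont); rewrite /g /= /dlt; lra.
have near_oo : \forall n \near \oo, g (x n, y n) <= dlt.
  near=> n; rewrite /g /=; apply: (le_trans (xyC n x' y' x'D y'D)).
  rewrite ler_pdivrMr ?ltr0n// mulrC -ler_pdivrMr//.
  have [C0|C0] := leP C 0;
    first by rewrite (@le_trans _ _ 0)// ler_pdivrMr// mul0r.
  apply: (@le_trans _ _ n%:R); last by rewrite ler_nat.
  near: n; exact: nbhs_infty_ger.
have [w [/= w1 w2]] := pcl [set w | g w <= dlt] _ near_oo near_p.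
by move: w2; rewrite ltNge w1.
Unshelve. all: by end_near.
Qed.

End zero_sum_game.

(** Since (d1 + d2)^2 <= 2 (d1^2 + d2^2), the variations cost at most 2 e^2 (L1^2 + L2^2) (d1^2 +
    d2^2), and the stepsize makes this coefficient exactly 1/4. *)
Lemma lipschitz_regret_bound (R : realFieldType) (L1 L2 e D1 D2 d1 d2 : R) :
  0 <= d1 -> 0 <= d2 -> 0 <= D1 -> 0 <= D2 -> 0 <= L1 -> 0 <= L2 ->
  D1 <= L1 * (d1 + d2) -> D2 <= L2 * (d1 + d2) ->
  e ^+ 2 * (8 * (L1 ^+ 2 + L2 ^+ 2)) = 1 ->
  (e ^+ 2 * D1 ^+ 2 - d1 ^+ 2 / 4) + (e ^+ 2 * D2 ^+ 2 - d2 ^+ 2 / 4) <= 0.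
Proof.
move=> d10 d20 D10 D20 L10 L20 H1 H2 He.
have S L D : 0 <= L -> 0 <= D -> D <= L * (d1 + d2) ->
    e ^+ 2 * D ^+ 2 <= e ^+ 2 * (2 * L ^+ 2 * (d1 ^+ 2 + d2 ^+ 2)).
  move=> L0 D0 H; apply: ler_wpM2l; first exact: sqr_ge0.
  apply: (@le_trans _ _ ((L * (d1 + d2)) ^+ 2)).
    by rewrite ler_pXn2r// nnegrE// mulr_ge0// addr_ge0.
  rewrite exprMn -mulrA [X in _ <= X]mulrCA; apply: ler_wpM2l;
    first exact: sqr_ge0.
  rewrite -subr_ge0.
  have -> : 2 * (d1 ^+ 2 + d2 ^+ 2) - (d1 + d2) ^+ 2 = (d1 - d2) ^+ 2 by ring.
  exact: sqr_ge0.
have := S _ _ L10 D10 H1; have := S _ _ L20 D20 H2.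
have E : e ^+ 2 * (2 * L1 ^+ 2 * (d1 ^+ 2 + d2 ^+ 2)) +
    e ^+ 2 * (2 * L2 ^+ 2 * (d1 ^+ 2 + d2 ^+ 2)) =
    (e ^+ 2 * (8 * (L1 ^+ 2 + L2 ^+ 2))) * ((d1 ^+ 2 + d2 ^+ 2) / 4) by field.
move: E; rewrite He; lra.
Qed.

(** * Duality gap of the averaged iterates *)

Section duality_gap.
Context {R : realType} {J1 J2 : ejaType R}.
Variables (f : J1 * J2 -> R) (L1 L2 : R) (x : nat -> J1) (y : nat -> J2).
Hypothesis f_diff : forall z, differentiable f z.
Hypothesis f_convex : forall b : J2, convex_function setT (fun a : J1 =>
  f (a, b)).
Hypothesis f_concave : forall a : J1, convex_function setT (fun b : J2 =>
  - f (a, b)).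
Hypotheses (L1_ge0 : 0 <= L1) (L2_ge0 : 0 <= L2) (L_neq0 :
  ~ (L1 = 0 /\ L2 = 0)).
Hypothesis lip1 : forall z z' : J1 * J2,
  (simplex J1 `*` simplex J2) z -> (simplex J1 `*` simplex J2) z' ->
  norm_troo (payoff1 f z - payoff1 f z') <= L1 * norm_tr1 (z - z').
Hypothesis lip2 : forall z z' : J1 * J2,
  (simplex J1 `*` simplex J2) z -> (simplex J1 `*` simplex J2) z' ->
  norm_troo (payoff2 f z - payoff2 f z') <= L2 * norm_tr1 (z - z').
Let sq := Num.sqrt (2 * (L1 ^+ 2 + L2 ^+ 2)).
Let eta := (2 * sq)^-1.
Hypothesis x_oscmwu : oscmwu eta (fun t => payoff1 f (x t, y t)) x.
Hypothesis y_oscmwu : oscmwu eta (fun t => payoff2 f (x t, y t)) y.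

Lemma stepsize_gt0 : 0 < sq.
Proof.
rewrite sqrtr_gt0 mulr_gt0// lt0r addr_ge0 ?sqr_ge0// andbT.
by rewrite paddr_eq0 ?sqr_ge0// !sqrf_eq0; apply/negP => /andP[/eqP ? /eqP ?];
  exact: L_neq0.
Qed.

Lemma oscmwu_simplex1 t : simplex J1 (x t).
Proof.
have [x0 xS] := x_oscmwu; case: t => [|t]; last by rewrite xS;
  exact: simplex_softmax.
by rewrite x0 -softmax0; exact: simplex_softmax.
Qed.

Lemma oscmwu_simplex2 t : simplex J2 (y t).
Proof.
have [y0 yS] := y_oscmwu; case: t => [|t]; last by rewrite yS;
  exact: simplex_softmax.
by rewrite y0 -softmax0; exact: simplex_softmax.
Qed.

(** The stepsize does not depend on T, so along a single run the bound holds at every horizon. The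
    factor 2 [sq] is the inverse of [eta]. *)
Lemma oscmwu_duality_gap T x' y' :
  (0 < T)%N -> simplex J1 x' -> simplex J2 y' ->
  f (T%:R^-1 *: \sum_(t < T) x t.+1, y') - f (x', T%:R^-1 *: \sum_(t < T) y
    t.+1) <=
  2 * (ln (rank J1)%:R + ln (rank J2)%:R) * sq / T%:R.
Proof.
move=> T0 x'D y'D.
have Tp : 0 < T%:R :> R by rewrite ltr0n.
have sq0 := stepsize_gt0.
have eta0 : 0 < eta by rewrite invr_gt0 mulr_gt0.
pose m1 t := payoff1 f (x t, y t); pose m2 t := payoff2 f (x t, y t).
have R1 := oscmwu_regret T (ltW eta0) x_oscmwu x'D.
have R2 := oscmwu_regret T (ltW eta0) y_oscmwu y'D.
have eta2 : eta ^+ 2 * (8 * (L1 ^+ 2 + L2 ^+ 2)) = 1.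
  have sq2 : sq ^+ 2 = 2 * (L1 ^+ 2 + L2 ^+ 2).
    by rewrite sqr_sqrtr// mulr_ge0// addr_ge0 ?sqr_ge0.
  have -> : 8 * (L1 ^+ 2 + L2 ^+ 2) = (2 * sq) ^+ 2 by rewrite exprMn sq2; ring.
  by rewrite -exprMn mulVf ?expr1n// mulf_neq0// gt_eqF.
have xyD t : (simplex J1 `*` simplex J2) (x t, y t).
  by split; [exact: oscmwu_simplex1|exact: oscmwu_simplex2].
have step t :
    (eta ^+ 2 * norm_troo (m1 t.+1 - m1 t) ^+ 2 - norm_tr1 (x t.+1 - x t) ^+ 2
      / 4) +
    (eta ^+ 2 * norm_troo (m2 t.+1 - m2 t) ^+ 2 - norm_tr1 (y t.+1 - y t) ^+ 2
      / 4) <= 0.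
  have xyN := norm_tr1_pair ((x t.+1, y t.+1) - (x t, y t)).
  apply: (lipschitz_regret_bound _ _ _ _ L1_ge0 L2_ge0) => //;
    rewrite ?norm_tr1_ge0 ?norm_troo_ge0//.
    by apply: le_trans (lip1 (xyD t.+1) (xyD t)) _; exact: ler_wpM2l.
  by apply: le_trans (lip2 (xyD t.+1) (xyD t)) _; exact: ler_wpM2l.
have sum_step : eta * (\sum_(t < T) jtr (m1 t.+1 ** (x' - x t.+1)) +
    \sum_(t < T) jtr (m2 t.+1 ** (y' - y t.+1))) <=
    ln (rank J1)%:R + ln (rank J2)%:R.
  rewrite mulrDr; apply: (le_trans (lerD R1 R2)).
  rewrite addrACA -big_split/= gerDl; apply: sumr_le0 => t _; exact: step.
have gap_sum : \sum_(t < T) f (x t.+1, y') - \sum_(t < T) f (x', y t.+1) <=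
    \sum_(t < T) jtr (m1 t.+1 ** (x' - x t.+1)) +
    \sum_(t < T) jtr (m2 t.+1 ** (y' - y t.+1)).
  rewrite -sumrB -big_split/=; apply: ler_sum => t _.
  have := payoff1_regret f_diff (x t.+1) x' (f_convex (y t.+1)).
  have := payoff2_regret f_diff (y t.+1) y' (f_concave (x t.+1)).
  by rewrite -/(m1 t.+1) -/(m2 t.+1); lra.
have avg1 : f (T%:R^-1 *: \sum_(t < T) x t.+1, y') <=
    T%:R^-1 * \sum_(t < T) f (x t.+1, y').
  apply: (@convex_average _ _ (fun a => f (a, y'))) => // z.
  exact: differentiable_section1.
have avg2 : - f (x', T%:R^-1 *: \sum_(t < T) y t.+1) <=
    - (T%:R^-1 * \sum_(t < T) f (x', y t.+1)).
  rewrite -mulrN -sumrN.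
  apply: (@convex_average _ _ (fun b => - f (x', b))) => // z.
  by apply: differentiableN; exact: differentiable_section2.
apply: (le_trans (lerD avg1 avg2)).
rewrite -mulrBr [leRHS]mulrC; apply: ler_wpM2l; first by rewrite invr_ge0 ltW.
apply: (le_trans gap_sum); rewrite -(ler_pM2l eta0) (le_trans sum_step)//.
by rewrite le_eqVlt; apply/orP; left; apply/eqP; rewrite /eta; field;
  rewrite gt_eqF.
Qed.

End duality_gap.

Theorem theorem11 (R : realType) (J1 J2 : ejaType R) (f : J1 * J2 -> R)
    (L1 L2 eps : R) (T : nat) (x : nat -> J1) (y : nat -> J2)
    (f_diff : forall z, differentiable f z)
    (f_convex : forall b : J2, convex_function setT (fun a : J1 => f (a, b)))
    (f_concave : forall a : J1, convex_function setT (fun b : J2 => - f (a, b)))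
    (L1_ge0 : 0 <= L1) (L2_ge0 : 0 <= L2) (L_neq0 : ~ (L1 = 0 /\ L2 = 0))
    (lip1 : forall z z' : J1 * J2,
       (simplex J1 `*` simplex J2) z -> (simplex J1 `*` simplex J2) z' ->
       norm_troo (payoff1 f z - payoff1 f z') <= L1 * norm_tr1 (z - z'))
    (lip2 : forall z z' : J1 * J2,
       (simplex J1 `*` simplex J2) z -> (simplex J1 `*` simplex J2) z' ->
       norm_troo (payoff2 f z - payoff2 f z') <= L2 * norm_tr1 (z - z'))
    (eps_gt0 : 0 < eps)
    (eta := (2 * Num.sqrt (2 * (L1 ^+ 2 + L2 ^+ 2)))^-1)
    (x_oscmwu : oscmwu eta (fun t => payoff1 f (x t, y t)) x)
    (y_oscmwu : oscmwu eta (fun t => payoff2 f (x t, y t)) y)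
    (T_ge1 : (1 <= T)%N)
    (T_large : 2 * (ln (rank J1)%:R + ln (rank J2)%:R) *
               Num.sqrt (2 * (L1 ^+ 2 + L2 ^+ 2)) / eps <= T%:R)
    (xbar := T%:R^-1 *: \sum_(1 <= t < T.+1) x t)
    (ybar := T%:R^-1 *: \sum_(1 <= t < T.+1) y t) :
  [/\ has_value f,
      0 <= gap f xbar ybar <= eps,
      0 <= gap1 f xbar <= eps,
      0 <= gap2 f ybar <= eps &
      saddle_point f eps xbar ybar].
Proof.
have gapT := oscmwu_duality_gap f_diff f_convex f_concave L1_ge0 L2_ge0 L_neq0
  lip1 lip2 x_oscmwu y_oscmwu.
have xD := oscmwu_simplex1 x_oscmwu.
have yD := oscmwu_simplex2 y_oscmwu.
have Tp : 0 < T%:R :> R by rewrite ltr0n.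
have xbarE : xbar = T%:R^-1 *: \sum_(t < T) x t.+1.
  by rewrite /xbar big_add1/= big_mkord.
have ybarE : ybar = T%:R^-1 *: \sum_(t < T) y t.+1.
  by rewrite /ybar big_add1/= big_mkord.
have xbarD : simplex J1 xbar by rewrite xbarE; exact: simplex_avg.
have ybarD : simplex J2 ybar by rewrite ybarE; exact: simplex_avg.
have f_gap x' y' : simplex J1 x' -> simplex J2 y' ->
    f (xbar, y') - f (x', ybar) <= eps.
  move=> x'D y'D; rewrite xbarE ybarE (le_trans (gapT _ _ _ _ x'D y'D))//.
  by rewrite ler_pdivrMr// [eps * _]mulrC -ler_pdivrMr.
(* The same run supplies the approximate saddle points, averaged over n + 1 rounds. *)
have value_f : has_value f.
  apply: (has_value_of_approximation f_diff
    (x := fun n => n.+1%:R^-1 *: \sum_(t < n.+1) x t.+1)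
    (y := fun n => n.+1%:R^-1 *: \sum_(t < n.+1) y t.+1)) =>
      [n|n|n x' y' x'D y'D].
  - exact: simplex_avg.
  - exact: simplex_avg.
  - exact: gapT.
have [_ _ [[_ _ _] minmax_lb] [_ maxmin_ub] minmaxE] := value_f.
have [[y1 y1D y1E] y1ub] := max_yP f_diff xbar.
have [[x1 x1D x1E] x1lb] := min_xP f_diff ybar.
have gap_le : gap f xbar ybar <= eps.
  by rewrite /gap -y1E -x1E; exact: f_gap.
(* The value lies between [min_x f ybar] and [max_y f xbar], so the two one-sided gaps are
   nonnegative and sum to [gap]. *)
have le_max : minmax f <= max_y f xbar by apply: minmax_lb; exists xbar.
have min_le : min_x f ybar <= minmax f.
  by rewrite minmaxE; apply: maxmin_ub; exists ybar.
move: gap_le; rewrite /gap /gap1 /gap2 => gap_le.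
split=> //; try by apply/andP; split; lra.
move=> x' y' x'D y'D.
have := f_gap xbar y' xbarD y'D; have := f_gap x' ybar x'D ybarD.
by move=> ? ?; apply/andP; split; lra.
Qed.
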